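(* For $i=1,2$ let $\Sigma_i\subset\mathbb{E}(\kappa,\tau)$ be an $H_i$-surface with unit normal $N_i$, where $H_i^2+\tau^2\neq0$, and suppose $\Sigma_1\cap\Sigma_2\neq\emptyset$. Let $\Gamma\subset\Sigma_1\cap\Sigma_2$ be a regular curve of transversal intersection. Assume that along $\Gamma$ it holds: a) $\langle N_1,N_2\rangle$ is constant, and b) $\sqrt{H_1^2+\tau^2}\,\langle\mathbf{T}^2_{\theta_2},N_1\rangle\langle J_2\mathbf{T}^2_{\theta_2},N_1\rangle=\sqrt{H_2^2+\tau^2}\,\langle\mathbf{T}^1_{\theta_1},N_2\rangle\langle J_1\mathbf{T}^1_{\theta_1},N_2\rangle,$ where $e^{2i\theta_i}=\frac{H_i+i\tau}{\sqrt{H_i^2+\tau^2}}$ (on the right-hand side of this definition, the $i$ multiplying $\tau$ and in the exponent is the imaginary unit), $\mathbf{T}^i_{\theta_i}=\cos\theta_i\,\mathbf{T}_i+\sin\theta_i\,J_i\mathbf{T}_i$ and $J_i\mathbf{T}^i_{\theta_i}=N_i\wedge\mathbf{T}^i_{\theta_i}$ for $i=1,2$. Then $\Gamma$ is an AR-line of curvature for $\Sigma_1$ if, and only if, $\Gamma$ is an AR-line of curvature for $\Sigma_2$.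
   Context: $\mathbb{E}(\kappa,\tau)$, with constants $\kappa,\tau$ such that $\kappa-4\tau^2\neq0$ (and $\kappa\in\{-1,0,1\}$), is the simply connected homogeneous Riemannian 3-manifold with 4-dimensional isometry group that fibers by a Riemannian submersion over the simply connected surface $\mathbb{M}^2(\kappa)$ of constant curvature $\kappa$. Its fibers are the trajectories of a unit Killing field $\xi$ (the vertical field) satisfying $\overline\nabla_X\xi=\tau X\wedge\xi$, where $\overline\nabla$ is the Levi-Civita connection and $\wedge$ the cross product. If $\tau=0$ it is $\mathbb{M}^2(\kappa)\times\mathbb{R}$. Let $\Sigma$ be an oriented immersed surface with unit normal $N$ and shape operator $AX=-\overline{\nabla}_XN$; its mean curvature is $H=\frac12\mathrm{tr}A$, and an $H$-surface is a surface of constant mean curvature $H$. Put $JX=N\wedge X$ for $X$ tangent to $\Sigma$, $\nu=\langle N,\xi\rangle$ and $\mathbf{T}=\xi-\nu N$; for $\Sigma_i$ these are written $J_i,\nu_i,\mathbf{T}_i$. The Abresch-Rosenberg shape operator $S_{AR}$ of an $H$-surface is defined as follows. - If $\tau=0$: $S_{AR}X=2H\,AX-\kappa\langle X,\mathbf{T}\rangle\mathbf{T}+\frac{\kappa}{2}|\mathbf{T}|^2X-2H^2X$. - If $\tau\neq0$: $S_{AR}X=AX-\alpha\langle\mathbf{T}_\theta,X\rangle\mathbf{T}_\theta+\frac{\alpha|\mathbf{T}|^2}{2}X-HX$, where $\alpha=\frac{\kappa-4\tau^2}{2\sqrt{H^2+\tau^2}}$, $e^{2\sqrt{-1}\,\theta}=\frac{H+\sqrt{-1}\,\tau}{\sqrt{H^2+\tau^2}}$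 and $\mathbf{T}_\theta=\cos\theta\,\mathbf{T}+\sin\theta\,J\mathbf{T}$. A regular curve $\Gamma$ on $\Sigma$ parametrized by $\gamma$ is an AR-line of curvature of $\Sigma$ if $S_{AR}(\gamma'(t))=\lambda(t)\gamma'(t)$ for some smooth real function $\lambda$. *)

(* Defs.v *)
From HB Require Import structures.
From mathcomp Require Import all_boot all_order all_algebra.
From mathcomp Require Import all_classical all_reals all_analysis.

Set Implicit Arguments.
Unset Strict Implicit.
Unset Printing Implicit Defensive.

Import Order.TTheory GRing.Theory Num.Theory.
Import numFieldNormedType.Exports.

Local Open Scope classical_set_scope.
Local Open Scope ring_scope.

(* C^k on U; only meaningful for U open and V finite-dimensional, which is the
   case in all the uses below. *)
Fixpoint Ck (R : realType) (V W : normedModType R) (k : nat) (U : set V)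
    (f : V -> W) : Prop :=
  match k with
  | 0 => forall x, U x -> {for x, continuous f}
  | k'.+1 => (forall x, U x -> differentiable f x) /\
             (forall v, Ck k' U (fun x => 'D_v f x))
  end.

Definition smooth_on (R : realType) (V W : normedModType R) (U : set V)
  (f : V -> W) : Prop := forall k, Ck k U f.

(* [cmap] is meaningful on [cdom] and [cinv] on the image [cimg]. *)
Record chart (R : realType) (n : nat) (T : Type) := Chart {
  cdom : set T;
  cmap : T -> 'rV[R]_n;
  cinv : 'rV[R]_n -> T }.

Definition cimg (R : realType) (n : nat) (T : Type) (c : chart R n T) :
  set 'rV[R]_n := cmap c @` cdom c.

Definition is_chart (R : realType) (n : nat) (T : topologicalType)
    (c : chart R n T) : Prop :=
  [/\ open (cdom c), open (cimg c),
      (forall p, cdom c p -> cinv c (cmap c p) = p),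
      (forall p, cdom c p -> {for p, continuous (cmap c)}) &
      (forall x, cimg c x -> {for x, continuous (cinv c)})].

Definition transition (R : realType) (n : nat) (T : Type) (c d : chart R n T) :
  'rV[R]_n -> 'rV[R]_n := fun x => cmap d (cinv c x).

(* Tangent vectors at p are represented by their components in the preferred
   chart [chart_at p], so that every tangent space is 'rV[R]_n. *)
Record manifold (R : realType) (n : nat) := Manifold {
  mpoint :> topologicalType;
  atlas : set (chart R n mpoint);
  chart_at : mpoint -> chart R n mpoint;
  m_hausdorff : hausdorff_space mpoint;
  m_second_countable : @second_countable mpoint;
  atlas_chart : forall c, atlas c -> is_chart c;
  chart_at_atlas : forall p, atlas (chart_at p);
  mem_chart_at : forall p, cdom (chart_at p) p;
  atlas_smooth : forall c d, atlas c -> atlas d ->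
    smooth_on (cmap c @` (cdom c `&` cdom d)) (transition c d) }.

Section Manifolds.
Variable R : realType.

(* Components in the chart d of the tangent vector at p with components u in
   the chart c. *)
Definition chart_change (n : nat) (M : manifold R n) (p : M)
  (c d : chart R n M) (u : 'rV[R]_n) : 'rV[R]_n :=
  'D_u (transition c d) (cmap c p).

Definition to_chart (n : nat) (M : manifold R n) (c : chart R n M) (p : M) :
  'rV[R]_n -> 'rV[R]_n := chart_change p (chart_at p) c.

Definition from_chart (n : nat) (M : manifold R n) (c : chart R n M) (p : M) :
  'rV[R]_n -> 'rV[R]_n := chart_change p c (chart_at p).

Definition smooth_map (m n : nat) (S : manifold R m) (M : manifold R n)
    (f : S -> M) : Prop :=
  continuous f /\
  forall c d, atlas c -> atlas d ->
    smooth_on (cmap c @` (cdom c `&` f @^-1` cdom d))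
              (fun x => cmap d (f (cinv c x))).

Definition differential (m n : nat) (S : manifold R m) (M : manifold R n)
    (f : S -> M) (p : S) (v : 'rV[R]_m) : 'rV[R]_n :=
  'D_v (fun x => cmap (chart_at (f p)) (f (cinv (chart_at p) x)))
       (cmap (chart_at p) p).

(* Smoothness of a vector field V along f, i.e. V p is a vector at f p.  Vector
   fields on M are fields along the identity. *)
Definition smooth_field (m n : nat) (S : manifold R m) (M : manifold R n)
    (f : S -> M) (V : S -> 'rV[R]_n) : Prop :=
  forall c d, atlas c -> atlas d ->
    smooth_on (cmap c @` (cdom c `&` f @^-1` cdom d))
              (fun x => to_chart d (f (cinv c x)) (V (cinv c x))).

Definition smooth_curve (n : nat) (M : manifold R n) (I : set R)
    (c : R -> M) : Prop :=
  (forall t, I t -> {for t, continuous c}) /\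
  forall d, atlas d ->
    @smooth_on R R^o 'rV[R]_n (I `&` c @^-1` cdom d) (fun t => cmap d (c t)).

Definition velocity (n : nat) (M : manifold R n) (c : R -> M) (t : R) :
  'rV[R]_n := derive1 (fun s : R => cmap (chart_at (c t)) (c s)) t.

Definition regular_curve (n : nat) (M : manifold R n) (I : set R)
    (c : R -> M) : Prop :=
  smooth_curve I c /\ forall t, I t -> velocity c t != 0.

Definition oriented_atlas (n : nat) (M : manifold R n) : Prop :=
  forall c d, atlas c -> atlas d -> forall p : M, cdom c p -> cdom d p ->
    0 < \det (lin1_mx (chart_change p c d)).

Definition simply_connected (T : topologicalType) : Prop :=
  (forall p q : T, exists g : R -> T,
     [/\ {within `[0, 1]%classic, continuous g}, g 0 = p & g 1 = q]) /\
  (forall g : R -> T, {within `[0, 1]%classic, continuous g} -> g 0 = g 1 ->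
     exists h : R * R -> T,
       [/\ {within `[0, 1]%classic `*` `[0, 1]%classic, continuous h},
           (forall t, t \in `[0, 1] -> h (0, t) = g t /\ h (1, t) = g 0) &
           (forall s, s \in `[0, 1] -> h (s, 0) = g 0 /\ h (s, 1) = g 0)]).

End Manifolds.

(* The metric [gm p] acts on tangent vectors at p.  The Levi-Civita connection
   is given by its Christoffel symbols: in the chart c, at the point with
   coordinates x,
     (nabla_u V)^c = 'D_u V^c x + christoffel c x u (V^c x).
   The last two axioms are torsion-freeness and compatibility with the metric;
   they determine the connection. *)
Record riemannian (R : realType) (n : nat) := Riemannian {
  rman :> manifold R n;
  gm : rman -> 'rV[R]_n -> 'rV[R]_n -> R;
  christoffel : chart R n rman -> 'rV[R]_n -> 'rV[R]_n -> 'rV[R]_n -> 'rV[R]_n;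
  metric_in := fun (c : chart R n rman) (x u v : 'rV[R]_n) =>
    gm (cinv c x) (from_chart c (cinv c x) u) (from_chart c (cinv c x) v);
  gm_sym : forall p u v, gm p u v = gm p v u;
  gm_linear : forall p a u v w, gm p (a *: u + v) w = a * gm p u w + gm p v w;
  gm_pos : forall p v, v != 0 -> 0 < gm p v v;
  gm_smooth : forall c, atlas c -> forall u v,
    @smooth_on R 'rV[R]_n R^o (cimg c) (fun x => metric_in c x u v);
  christoffel_linearl : forall c, atlas c -> forall x, cimg c x ->
    forall a u v w, christoffel c x (a *: u + v) w =
                    a *: christoffel c x u w + christoffel c x v w;
  christoffel_linearr : forall c, atlas c -> forall x, cimg c x ->
    forall a u v w, christoffel c x w (a *: u + v) =
                    a *: christoffel c x w u + christoffel c x w v;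
  christoffel_smooth : forall c, atlas c -> forall u v,
    smooth_on (cimg c) (fun x => christoffel c x u v);
  christoffel_change : forall c d, atlas c -> atlas d ->
    forall p, cdom c p -> cdom d p -> forall u v,
      christoffel d (cmap d p) (chart_change p c d u) (chart_change p c d v) =
      chart_change p c d (christoffel c (cmap c p) u v)
      - 'D_u (fun x => 'D_v (transition c d) x) (cmap c p);
  christoffel_sym : forall c, atlas c -> forall x, cimg c x ->
    forall u v, christoffel c x u v = christoffel c x v u;
  christoffel_metric : forall c, atlas c -> forall x, cimg c x ->
    forall u v w,
      'D_w ((fun y => metric_in c y u v) : 'rV[R]_n -> R^o) x =
      metric_in c x (christoffel c x w u) v +
      metric_in c x u (christoffel c x w v) }.

Section Riemannian.
Variable R : realType.

(* Covariant derivative at p, in the direction of the tangent vector v of S at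
   p, of a vector field V along f : S -> M, for the Levi-Civita connection. *)
Definition nabla_along (m n : nat) (S : manifold R m) (M : riemannian R n)
    (f : S -> M) (V : S -> 'rV[R]_n) (p : S) (v : 'rV[R]_m) : 'rV[R]_n :=
  let c := chart_at p in
  let d := chart_at (f p) in
  'D_v (fun x => to_chart d (f (cinv c x)) (V (cinv c x))) (cmap c p)
  + christoffel d (cmap d (f p)) (differential f p v) (V p).

Definition nabla (n : nat) (M : riemannian R n) (V : M -> 'rV[R]_n) (p : M)
  (u : 'rV[R]_n) : 'rV[R]_n := nabla_along (fun q : M => q) V p u.

Definition isometry (n : nat) (M : riemannian R n) (f : M -> M) : Prop :=
  [/\ smooth_map f,
      (exists h : M -> M, [/\ smooth_map h, cancel f h & cancel h f]) &
      forall p u v,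
        gm (f p) (differential f p u) (differential f p v) = gm p u v].

Definition homogeneous (n : nat) (M : riemannian R n) : Prop :=
  forall p q : M, exists2 f : M -> M, isometry f & f p = q.

Definition killing_field (n : nat) (M : riemannian R n)
    (K : M -> 'rV[R]_n) : Prop :=
  smooth_field (fun p : M => p) K /\
  forall p u v, gm p (nabla K p u) v + gm p u (nabla K p v) = 0.

(* The Lie algebra of the isometry group of a homogeneous (hence complete)
   Riemannian manifold is the space of its Killing fields. *)
Definition isometry_group_dim (n : nat) (M : riemannian R n) (k : nat) : Prop :=
  exists K : 'I_k -> M -> 'rV[R]_n,
    [/\ forall i, killing_field (K i),
        forall a : 'I_k -> R, (forall p, \sum_i a i *: K i p = 0) ->
          forall i, a i = 0 &
        forall L : M -> 'rV[R]_n, killing_field L ->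
          exists a : 'I_k -> R, forall p, L p = \sum_i a i *: K i p].

Definition gram (n : nat) (M : riemannian R n) (p : M) : 'M[R]_n :=
  \matrix_(i, j) gm p (delta_mx 0 i) (delta_mx 0 j).

(* Riemannian volume form, for the orientation given by the atlas. *)
Definition vol3 (M : riemannian R 3) (p : M) (u v w : 'rV[R]_3) : R :=
  Num.sqrt (\det (gram p)) * \det (col_mx u (col_mx v w) : 'M[R]_(1 + (1 + 1))).

(* The vector such that gm p (cross p u v) w = vol3 p u v w for all w. *)
Definition cross (M : riemannian R 3) (p : M) (u v : 'rV[R]_3) : 'rV[R]_3 :=
  (\row_k vol3 p u v (delta_mx 0 k)) *m invmx (gram p).

(* For kappa = -1, 0, 1, the surface M^2(kappa) is realized in R^3 as the upper
   sheet of the hyperboloid z^2 - x^2 - y^2 = 1, the plane z = 1, and the unit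
   sphere, with the metric induced by dx^2 + dy^2 + kappa dz^2. *)
Definition base_surface (kappa : R) : set 'rV[R]_3 :=
  [set x | kappa * (x 0 0 ^+ 2 + x 0 1 ^+ 2) + x 0 ord_max ^+ 2 = 1 /\
           (kappa <= 0 -> 0 < x 0 ord_max)].

Definition base_metric (kappa : R) (u v : 'rV[R]_3) : R :=
  u 0 0 * v 0 0 + u 0 1 * v 0 1 + kappa * (u 0 ord_max * v 0 ord_max).

Definition smooth_to_space (n m : nat) (M : manifold R n)
    (f : M -> 'rV[R]_m) : Prop :=
  forall c, atlas c -> smooth_on (cimg c) (fun x => f (cinv c x)).

Definition differential_to_space (n m : nat) (M : manifold R n)
    (f : M -> 'rV[R]_m) (p : M) (v : 'rV[R]_n) : 'rV[R]_m :=
  'D_v (fun x => f (cinv (chart_at p) x)) (cmap (chart_at p) p).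

(* pr is a Riemannian submersion of M onto M^2(kappa), whose vertical lines are
   spanned by xi. *)
Definition riemannian_submersion (kappa : R) (M : riemannian R 3)
    (xi : M -> 'rV[R]_3) (pr : M -> 'rV[R]_3) : Prop :=
  [/\ smooth_to_space pr,
      range pr = base_surface kappa,
      forall p v, differential_to_space pr p v = 0 <->
                  exists a, v = a *: xi p &
      forall p u v, gm p u (xi p) = 0 -> gm p v (xi p) = 0 ->
        base_metric kappa (differential_to_space pr p u)
                          (differential_to_space pr p v) = gm p u v].

Definition trajectory (M : manifold R 3) (xi : M -> 'rV[R]_3)
    (s : R -> M) : Prop :=
  smooth_curve setT s /\ forall t, velocity s t = xi (s t).

End Riemannian.

(* The orientation is the one for which nabla_X xi = tau X /\ xi; isometric copies
   are not distinguished. *)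
Record E_space (R : realType) (kappa tau : R) := ESpace {
  Eman :> riemannian R 3;
  E_oriented : oriented_atlas Eman;
  E_simply_connected : simply_connected R Eman;
  E_homogeneous : homogeneous Eman;
  E_isometry_dim : isometry_group_dim Eman 4;
  E_proj : Eman -> 'rV[R]_3;
  xi : Eman -> 'rV[R]_3;
  E_submersion : riemannian_submersion kappa xi E_proj;
  E_fibers : forall p q : Eman, E_proj p = E_proj q <->
    exists s : R -> Eman, [/\ trajectory xi s, s 0 = p & exists t, s t = q];
  xi_unit : forall p, gm p (xi p) (xi p) = 1;
  xi_killing : killing_field xi;
  xi_nabla : forall p u, nabla xi p u = tau *: cross p u (xi p) }.

Record surface (R : realType) (kappa tau : R) (E : E_space kappa tau) :=
  Surface {
  sman :> manifold R 2;
  imm : sman -> E;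
  imm_smooth : smooth_map imm;
  imm_immersion : forall p v, differential imm p v = 0 -> v = 0;
  normal : sman -> 'rV[R]_3;
  normal_smooth : smooth_field imm normal;
  normal_unit : forall p, gm (imm p) (normal p) (normal p) = 1;
  normal_orth : forall p v, gm (imm p) (normal p) (differential imm p v) = 0 }.

Section Surfaces.
Variables (R : realType) (kappa tau : R) (E : E_space kappa tau).
Variable S : surface E.

(* A tangent vector X of the surface at p is given by its components
   v : 'rV[R]_2 in the chart at p; as a vector of E it is [dimm p v].  The
   operators A and S_AR send v to a vector of E tangent to the surface. *)
Definition dimm (p : S) (v : 'rV[R]_2) : 'rV[R]_3 :=
  differential (@imm R kappa tau E S) p v.

Definition shape (p : S) (v : 'rV[R]_2) : 'rV[R]_3 :=
  - nabla_along (@imm R kappa tau E S) (@normal R kappa tau E S) p v.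

Definition first_form (p : S) : 'M[R]_2 :=
  \matrix_(i, j) gm (imm p) (dimm p (delta_mx 0 i)) (dimm p (delta_mx 0 j)).

Definition second_form (p : S) : 'M[R]_2 :=
  \matrix_(i, j) gm (imm p) (shape p (delta_mx 0 i)) (dimm p (delta_mx 0 j)).

(* Matrix of A on the tangent plane: A X_i = \sum_j a_ij X_j for the coordinate
   basis X_j, so that second_form = a *m first_form. *)
Definition shape_mx (p : S) : 'M[R]_2 :=
  second_form p *m invmx (first_form p).

Definition mean_curvature (p : S) : R := 2^-1 * \tr (shape_mx p).

Definition H_surface (H : R) : Prop := forall p, mean_curvature p = H.

Definition rotJ (p : S) (X : 'rV[R]_3) : 'rV[R]_3 := cross (imm p) (normal p) X.

Definition nu (p : S) : R := gm (imm p) (normal p) (xi (imm p)).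

Definition tanT (p : S) : 'rV[R]_3 := xi (imm p) - nu p *: normal p.

Definition tanT_angle (theta : R) (p : S) : 'rV[R]_3 :=
  cos theta *: tanT p + sin theta *: rotJ p (tanT p).

End Surfaces.

(* Real and imaginary parts of
   e^{2 sqrt(-1) theta} = (H + sqrt(-1) tau) / sqrt (H^2 + tau^2). *)
Definition AR_angle (R : realType) (H tau theta : R) : Prop :=
  cos (2 * theta) = H / Num.sqrt (H ^+ 2 + tau ^+ 2) /\
  sin (2 * theta) = tau / Num.sqrt (H ^+ 2 + tau ^+ 2).

Section AbreschRosenberg.
Variables (R : realType) (kappa tau : R) (E : E_space kappa tau).
Variable S : surface E.

(* Abresch-Rosenberg shape operator of an H-surface; theta is meant to satisfy
   AR_angle H tau theta, and is not used when tau = 0. *)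
Definition S_AR (H theta : R) (p : S) (v : 'rV[R]_2) : 'rV[R]_3 :=
  let X := dimm p v in
  let AX := shape p v in
  let T := tanT p in
  let T2 := gm (imm p) T T in
  if tau == 0 then
    (2 * H) *: AX - (kappa * gm (imm p) X T) *: T
    + (kappa / 2 * T2) *: X - (2 * H ^+ 2) *: X
  else
    let alpha := (kappa - 4 * tau ^+ 2) / (2 * Num.sqrt (H ^+ 2 + tau ^+ 2)) in
    let Tt := tanT_angle theta p in
    AX - (alpha * gm (imm p) Tt X) *: Tt + (alpha * T2 / 2) *: X - H *: X.

(* c is the curve in the abstract surface, Gamma its image under [imm]. *)
Definition AR_line (H theta : R) (I : set R) (c : R -> S) : Prop :=
  exists2 lambda : R -> R, @smooth_on R R^o R^o I lambda &
    forall t, I t ->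
      S_AR H theta (c t) (velocity c t) = lambda t *: dimm (c t) (velocity c t).

End AbreschRosenberg.

(* Main.v *)
Require Import Defs.
From HB Require Import structures.
From mathcomp Require Import all_boot all_order all_algebra.
From mathcomp Require Import all_classical all_reals all_analysis.
From mathcomp Require Import ring lra.

Set Implicit Arguments.
Unset Strict Implicit.
Unset Printing Implicit Defensive.

Import Order.TTheory GRing.Theory Num.Theory.
Import numFieldNormedType.Exports.

Local Open Scope classical_set_scope.
Local Open Scope ring_scope.

(** Let X be the velocity of the curve and N_1, N_2 the two normals along it.
    Both X and S_AR X are tangent to Sigma_i, so the curve is an AR-line of
    Sigma_i exactly when <J_i X, S_AR X> = vol (N_i, X, S_AR X) vanishes along
    it ([AR_lineP]).  This number is a combination of the geodesic torsion
    <J_i X, A_i X> and of the product <T_theta, X> <T_theta, J_i X>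
    ([vol3_S_AR]), and each hypothesis controls one of the two terms.

    Differentiating <N_1, N_2> = const gives <A_1 X, N_2> + <N_1, A_2 X> = 0.
    In the orthogonal basis N_1, X, J_1 X the vector N_2 has no component along
    X, and its component along J_1 X is, up to sign, that of N_1 along J_2 X;
    transversality makes it nonzero.  Hence the two geodesic torsions agree
    ([geodesic_torsion_eq], in the spirit of Joachimsthal's theorem).  Expanding
    b) in the same bases shows that the two products, divided by
    sqrt (H_i^2 + tau^2), agree as well ([condition_along]).  For tau <> 0 the
    two numbers <J_i X, S_AR X> are therefore equal.  For tau = 0 the vector
    T_theta is T or J T up to sign, the product is sgn (H_i) <T, X> <T, J_i X>,
    and the two numbers are proportional with the nonzero factors H_1 and H_2
    ([vol3_S_AR_eq]).

    Being an AR-line also asks for a smooth eigenvalue, here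
    <S_AR X, X> / <X, X>.  The shape operator and the tangent spaces are
    expressed in a chart that varies with the point, so smoothness is read off
    in a fixed chart after showing that the covariant derivative along a curve
    does not depend on the chart ([cov_change]).  The cross product in T_theta
    is traded for a covariant derivative of the Killing field,
    <J T, X> = - tau^-1 <nabla_X xi, N> ([rotJ_tanT_velocity]), so that only the
    metric and covariant derivatives of smooth fields are left
    ([S_AR_smooth]). *)

(** * Functions of class C^k *)

Section Calculus.
Variable R : realType.
Implicit Types V W X : normedModType R.

Lemma near_differentiable V W (f g : V -> W) (x : V) :
  {near x, f =1 g} -> differentiable f x -> differentiable g x.
Proof.
move=> fg df; have gfx : g x = f x by rewrite (nbhs_singleton fg).
have gd : g \o shift x = cst (g x) + 'd f x +o_ 0 id.
  rewrite gfx; apply/eqaddoP => e e0.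
  have /eqaddoP /(_ e e0) H := diff_locally df.
  have fgs : \forall h \near (0 : V), f (h + x) = g (h + x).
    have H' : \near x, f x = g x by exact: fg.
    by move: H'; rewrite (near_shift 0 x) subr0.
  by apply: filterS2 fgs H => h fgh; rewrite !fctE /= fgh.
have cd : continuous ('d f x) by exact: diff_continuous.
by apply/diff_locallyP; rewrite (diff_unique cd gd).
Qed.

Lemma open_near V W (U : set V) (f g : V -> W) x :
  open U -> U x -> (forall y, U y -> f y = g y) -> {near x, f =1 g}.
Proof. by move=> oU Ux fg; apply: filterS (open_nbhs_nbhs (conj oU Ux)). Qed.

(** Openness of U is what turns equality on U into equality near each point,
    which is all that derivatives see. *)
Lemma Ck_ext V W k (U : set V) (f g : V -> W) :
  open U -> (forall x, U x -> f x = g x) -> Ck k U f -> Ck k U g.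
Proof.
move=> oU; elim: k => [|k IH] in f g *.
  move=> fg fc x Ux; have near_fg := open_near oU Ux fg.
  rewrite /prop_for /continuous_at -(fg _ Ux).
  apply: cvg_trans (fc x Ux); apply: near_eq_cvg.
  exact: near_fg.
move=> fg [df Df]; split=> [x Ux|v].
  exact: near_differentiable (open_near oU Ux fg) (df x Ux).
apply: IH (Df v) => x Ux.
exact: near_eq_derive (open_near oU Ux fg).
Qed.

Lemma Ck_sub V W k (U U' : set V) (f : V -> W) :
  U `<=` U' -> Ck k U' f -> Ck k U f.
Proof.
move=> sU; elim: k => [|k IH] in f *; first by move=> H x /sU; exact: H.
by move=> [df Df]; split=> [x /sU|v]; [exact: df|exact: IH (Df v)].
Qed.

(** [Ck] only involves conditions at the points of U, so a neighbourhood may be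
    chosen for each point separately; U' is not asked to lie in U. *)
Lemma Ck_local V W k (U : set V) (f : V -> W) :
  (forall x, U x -> exists2 U' : set V, U' x & Ck k U' f) -> Ck k U f.
Proof.
elim: k => [|k IH] in f *; first by move=> H x /H [U' U'x]; exact.
move=> H; split=> [x /H [U' U'x [df _]]|v]; first exact: df.
by apply: IH => x /H [U' U'x [_ Df]]; exists U' => //; exact: Df.
Qed.

Lemma CkS V W k (U : set V) (f : V -> W) : Ck k.+1 U f -> Ck k U f.
Proof.
elim: k => [|k IH] in f *.
  by move=> [df _] x Ux; apply: differentiable_continuous; exact: df.
by move=> [df Df]; split=> [//|v]; exact: IH (Df v).
Qed.

Lemma Ck_cst V W k (U : set V) (c : W) : Ck k U (fun=> c).
Proof.
elim: k => [|k IH] in c *; first by move=> x _; exact: cst_continuous.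
split=> [x _|v]; first exact: differentiable_cst.
suff -> : 'D_v (fun=> c : W) = (fun=> 0) :> (V -> W) by exact: IH.
by apply/funext=> x; exact: derive_cst.
Qed.

Lemma Ck_add V W k (U : set V) (f g : V -> W) : open U ->
  Ck k U f -> Ck k U g -> Ck k U (fun x => f x + g x).
Proof.
move=> oU; elim: k => [|k IH] in f g *.
  by move=> cf cg x Ux; apply: cvgD; [exact: cf|exact: cg].
move=> [df Df] [dg Dg]; split=> [x Ux|v].
  by apply: differentiableD; [exact: df|exact: dg].
apply: (Ck_ext oU) (IH _ _ (Df v) (Dg v)) => x Ux.
by rewrite [RHS]deriveD //; apply: diff_derivable; [exact: df|exact: dg].
Qed.

(** Chain rule through the continuous bilinear map (a, w) |-> a *: w. *)
Lemma scale_diff V W (k : V -> R) (f : V -> W) x v :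
  differentiable k x -> differentiable f x ->
  differentiable (fun y => k y *: f y) x /\
  'D_v (fun y => k y *: f y) x = 'D_v k x *: f x + k x *: 'D_v f x.
Proof.
move=> dk df.
have bil : bilinear_for (GRing.Scale.Law.clone _ _ *:%R _)
  (GRing.Scale.Law.clone _ _ *:%R _) (fun (a : R) (w : W) => a *: w).
  split=> [w|a] b y z /=; first by rewrite scalerDl scalerA.
  by rewrite scalerDr !scalerA mulrC.
pose bM := bilinear_isBilinear.Build R R W W _ _ _ bil.
pose B : {bilinear R -> W -> W} := HB.pack (fun (a : R) (w : W) => a *: w) bM.
have cB : continuous (fun p => B p.1 p.2) by move=> p; exact: scale_continuous.
have dp : differentiable (fun y => (k y, f y)) x by exact: differentiable_pair.
have dB : differentiable (fun p => B p.1 p.2) (k x, f x).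
  exact: differentiable_bilin.
split; first exact: (differentiable_comp dp dB).
rewrite !deriveE //; last exact: (differentiable_comp dp dB).
rewrite [X in 'd X x](_ : _ = (fun p => B p.1 p.2) \o (fun y => (k y, f y))) //.
by rewrite diff_comp // diff_bilin //= diff_pair //= addrC.
Qed.

Lemma Ck_scale V W k (U : set V) (a : V -> R^o) (f : V -> W) : open U ->
  Ck k U a -> Ck k U f -> Ck k U (fun x => a x *: f x).
Proof.
move=> oU; elim: k => [|k IH] in a f *.
  by move=> ca cf x Ux; apply: cvgZ; [exact: ca|exact: cf].
move=> a1 f1; have := (a1, f1) => -[[da Da] [df Df]]; split=> [x Ux|v].
  by have [] := scale_diff 0 (da x Ux) (df x Ux).
have H := Ck_add oU (IH _ _ (Da v) (CkS f1)) (IH _ _ (CkS a1) (Df v)).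
apply: (Ck_ext oU) H => x Ux.
by have [_ ->] := scale_diff v (da x Ux) (df x Ux).
Qed.

Lemma Ck_sum V W k (U : set V) n (f : 'I_n -> V -> W) : open U ->
  (forall i, Ck k U (f i)) -> Ck k U (fun x => \sum_i f i x).
Proof.
move=> oU; elim: n => [|n IH] in f *.
  move=> _; have -> : (fun x => \sum_i f i x) = (fun=> 0).
    by apply/funext => x; rewrite big_ord0.
  exact: Ck_cst.
move=> H; rewrite (_ : (fun x => _) = (fun x =>
  f ord0 x + \sum_i f (lift ord0 i) x)).
  by apply: Ck_add => //; exact: IH.
by apply/funext => x; rewrite big_ord_recl.
Qed.

Lemma comp_diff V W X (f : V -> W) (g : W -> X) x v :
  differentiable f x -> differentiable g (f x) ->
  differentiable (fun y => g (f y)) x /\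
  'D_v (fun y => g (f y)) x = 'D_('D_v f x) g (f x).
Proof.
move=> df dg; have dgf := differentiable_comp df dg.
by split=> //; rewrite !deriveE // [X in 'd X x](_ : _ = g \o f) // diff_comp.
Qed.

Lemma coord_diff V n (f : V -> 'rV[R]_n) x v i : differentiable f x ->
  differentiable (fun y => f y 0 i : R) x /\
  'D_v (fun y => f y 0 i : R) x = 'D_v f x 0 i.
Proof.
move=> df; have dc := differentiable_coord (f x) 0 i.
have [H1 H2] := comp_diff v df dc; split => //.
rewrite H2 deriveE //.
pose c : 'rV[R]_n -> R := fun N => N 0 i.
have lc : linear c by move=> a u w; rewrite /c !mxE.
pose cM := GRing.isLinear.Build _ _ _ _ _ lc.
pose cL : {linear 'rV[R]_n -> R} := HB.pack c cM.
have -> : (fun N : 'rV[R]_n => N 0 i) = cL by [].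
rewrite diff_lin //; exact: coord_continuous.
Qed.

Lemma Ck_coord V k (U : set V) n (f : V -> 'rV[R]_n) i : open U ->
  Ck k U f -> Ck k U (fun x => f x 0 i : R^o).
Proof.
move=> oU; elim: k => [|k IH] in f *.
  move=> cf x Ux; pose c := fun N : 'rV[R]_n => N 0 i.
  by apply: (@continuous_comp _ _ _ f c x (cf x Ux)); exact: coord_continuous.
move=> [df Df]; split=> [x Ux|v]; first by have [] := coord_diff 0 i (df x Ux).
apply: (Ck_ext oU) (IH _ (Df v)) => x Ux.
by have [_ ->] := coord_diff v i (df x Ux).
Qed.

Lemma linear_coord n W (L : 'rV[R]_n -> W) u : linear L ->
  L u = \sum_j u 0 j *: L (delta_mx 0 j).
Proof.
move=> linL; pose LM := GRing.isLinear.Build _ _ _ _ _ linL.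
pose LL : {linear 'rV[R]_n -> W} := HB.pack L LM.
rewrite -[L]/(LL : _ -> _) {1}(row_sum_delta u) linear_sum.
by apply: eq_bigr => j _; rewrite linearZ.
Qed.

(** Smoothness of x |-> L x (u x) follows from the entries of the matrix of L x
    and the coordinates of u.  Metrics, Christoffel symbols and differentials
    all enter in this form. *)
Lemma Ck_linear_family V W k (U : set V) n (L : V -> 'rV[R]_n -> W)
    (u : V -> 'rV[R]_n) : open U -> (forall x, U x -> linear (L x)) ->
  (forall j, Ck k U (fun x => L x (delta_mx 0 j))) -> Ck k U u ->
  Ck k U (fun x => L x (u x)).
Proof.
move=> oU linL CL Cu.
apply: (@Ck_ext _ _ _ _ (fun x => \sum_j u x 0 j *: L x (delta_mx 0 j))) => //.
  by move=> x Ux; rewrite [RHS]linear_coord //; exact: linL.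
apply: Ck_sum => // j; apply: Ck_scale => //; exact: Ck_coord.
Qed.

Lemma derive_linear n W (f : 'rV[R]_n -> W) x :
  differentiable f x -> linear (fun v => 'D_v f x).
Proof. by move=> df a u v; rewrite !deriveE // linearP. Qed.

(** The derivative of g \o f in the direction v is the derivative of g in the
    direction 'D_v f x, which moves with x; expanding it over the coordinate
    directions gives functions to which the induction hypothesis applies. *)
Lemma Ck_comp V W k (U : set V) n (O : set 'rV[R]_n) (f : V -> 'rV[R]_n)
    (g : 'rV[R]_n -> W) : open U -> (forall x, U x -> O (f x)) ->
  Ck k U f -> Ck k O g -> Ck k U (fun x => g (f x)).
Proof.
move=> oU UO; elim: k => [|k IH] in g *.
  by move=> cf cg x Ux; apply: (@continuous_comp _ _ _ f g x (cf x Ux));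
    apply/cg/UO.
move=> f1; have := f1 => -[df Df] [dg Dg]; split=> [x Ux|v].
  by have [] := comp_diff 0 (df x Ux) (dg _ (UO _ Ux)).
apply: (@Ck_ext _ _ _ _ (fun x => 'D_('D_v f x) g (f x))) => //.
  by move=> x Ux; have [_ ->] := comp_diff v (df x Ux) (dg _ (UO _ Ux)).
apply: (@Ck_linear_family _ _ _ _ n (fun x w => 'D_w g (f x))) => //.
  by move=> x Ux; apply: derive_linear; exact/dg/UO.
  by move=> j; exact: IH (CkS f1) (Dg _).
exact: Df.
Qed.

Lemma Ck_inv V k (U : set V) (a : V -> R^o) : open U ->
  (forall x, U x -> a x != 0) -> Ck k U a -> Ck k U (fun x => (a x)^-1 : R^o).
Proof.
move=> oU a0; elim: k => [|k IH] in a a0 *.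
  by move=> ca x Ux; apply: cvgV; [exact: a0|exact: ca].
move=> a1; have := a1 => -[da Da]; split=> [x Ux|v].
  by apply: differentiableV; [exact: da|exact: a0].
have iva := IH _ a0 (CkS a1).
have H := Ck_scale oU (Ck_scale oU (Ck_cst k U (-1 : R^o)) iva)
  (Ck_scale oU iva (Da v)).
apply: (Ck_ext oU) H => x Ux.
rewrite [RHS]deriveV; [|exact: a0|by apply: diff_derivable; exact: da].
by rewrite /GRing.scale /= mulN1r !mulNr mulrA -expr2 exprVn.
Qed.

End Calculus.

(** * Metric and volume form at a point *)

Section Metric.
Variables (R : realType) (n : nat) (M : riemannian R n) (p : M).
Implicit Types (u v w : 'rV[R]_n) (a : R).

Lemma gm_linearl w : linear (fun u => gm p u w : R^o).
Proof. by move=> a u v; exact: gm_linear. Qed.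

Lemma gm_linearr w : linear (fun u => gm p w u : R^o).
Proof. by move=> a u v; rewrite !(gm_sym _ w) gm_linear. Qed.

Lemma gmDl u v w : gm p (u + v) w = gm p u w + gm p v w.
Proof. by rewrite -[u]scale1r gm_linear scale1r mul1r. Qed.

Lemma gmDr u v w : gm p u (v + w) = gm p u v + gm p u w.
Proof. by rewrite !(gm_sym _ u) gmDl. Qed.

Lemma gm0l v : gm p 0 v = 0.
Proof. by apply: (addrI (gm p 0 v)); rewrite -gmDl !addr0. Qed.

Lemma gmZl a u v : gm p (a *: u) v = a * gm p u v.
Proof. by rewrite -[a *: u]addr0 gm_linear gm0l addr0. Qed.

Lemma gmZr a u v : gm p u (a *: v) = a * gm p u v.
Proof. by rewrite !(gm_sym _ u) gmZl. Qed.

Lemma gmNl u v : gm p (- u) v = - gm p u v.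
Proof. by rewrite -scaleN1r gmZl mulN1r. Qed.

Lemma gmNr u v : gm p u (- v) = - gm p u v.
Proof. by rewrite !(gm_sym _ u) gmNl. Qed.

Lemma gmBl u v w : gm p (u - v) w = gm p u w - gm p v w.
Proof. by rewrite gmDl gmNl. Qed.

Lemma gmE u v : gm p u v = (u *m gram p *m v^T) 0 0.
Proof.
rewrite (linear_coord u (gm_linearl v)) /= -mulmxA !mxE.
apply: eq_bigr => i _; rewrite (linear_coord v (gm_linearr _)) /= !mxE.
by congr (_ * _); apply: eq_bigr => j _; rewrite !mxE [LHS]mulrC.
Qed.

End Metric.

Section Volume.
Variables (R : realType) (M : riemannian R 3) (p : M).
Implicit Types (u v w : 'rV[R]_3).

Let i0 : 'I_3 := ord0.
Let i1 : 'I_3 := lift ord0 ord0.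
Let i2 : 'I_3 := lift ord0 (lift ord0 ord0).

(** Laplace expansion, in the index form produced by [big_ord_recl]. *)
Lemma det3 (A : 'M[R]_3) : \det A =
  A i0 i0 * (A i1 i1 * A i2 i2 - A i1 i2 * A i2 i1)
  - A i0 i1 * (A i1 i0 * A i2 i2 - A i1 i2 * A i2 i0)
  + A i0 i2 * (A i1 i0 * A i2 i1 - A i1 i1 * A i2 i0).
Proof.
pose a (k l : nat) := A (inord k) (inord l).
have aE i j : A i j = a i j by rewrite /a !inord_val.
rewrite (expand_det_row _ i0) !big_ord_recl big_ord0 /cofactor.
rewrite !(expand_det_row _ (ord0 : 'I_2)) !big_ord_recl !big_ord0 /cofactor.
rewrite !det_mx11 !mxE !aE /= /bump /=.
ring.
Qed.

Definition rows3 u v w : 'M[R]_3 := col_mx u (col_mx v w).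

Lemma row_rows3 u v w :
  [/\ row i0 (rows3 u v w) = u, row i1 (rows3 u v w) = v &
      row i2 (rows3 u v w) = w].
Proof.
have E0 : i0 = lshift 2 (ord0 : 'I_1) by apply/val_inj.
have E1 : i1 = rshift 1 (lshift 1 (ord0 : 'I_1)) by apply/val_inj.
have E2 : i2 = rshift 1 (rshift 1 (ord0 : 'I_1)) by apply/val_inj.
split; apply/rowP => j; rewrite mxE.
- rewrite E0; exact: (col_mxEu u (col_mx v w) ord0 j).
- rewrite E1; exact: (etrans (col_mxEd u (col_mx v w) _ j) (col_mxEu v w ord0
  j)).
- rewrite E2; exact: (etrans (col_mxEd u (col_mx v w) _ j) (col_mxEd v w ord0
  j)).
Qed.

Lemma vol3E u v w :
  vol3 p u v w = Num.sqrt (\det (gram p)) * \det (rows3 u v w).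
Proof. by []. Qed.

Lemma rows3_gram (A B : 'M[R]_3) i j :
  (A *m gram p *m B^T) i j = gm p (row i A) (row j B).
Proof.
by rewrite gmE -row_mul !mxE; apply: eq_bigr => k _; rewrite !mxE.
Qed.

(** Sylvester's criterion for a 3 x 3 matrix: both leading minors are read off
    as squared norms of vectors with cofactors as coordinates. *)
Lemma gram_det_gt0 : 0 < \det (gram p).
Proof.
pose e i : 'rV[R]_3 := delta_mx 0 i.
have gS i j : gram p i j = gram p j i by rewrite !mxE gm_sym.
have gE i j : gm p (e i) (e j) = gram p i j by rewrite mxE.
have e_neq0 (x : 'rV[R]_3) j : x 0 j != 0 -> x != 0.
  by apply: contraNneq => ->; rewrite mxE.
set a := gram p i0 i0; set b := gram p i0 i1; set c := gram p i1 i1.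
set f := gram p i0 i2; set g := gram p i1 i2; set h := gram p i2 i2.
have a0 : 0 < a.
  by rewrite /a -gE; apply: gm_pos; apply: (e_neq0 _ i0);
    rewrite mxE eqxx oner_eq0.
have D2 : 0 < a * c - b ^+ 2.
  (* Orthogonal to e i0, with squared norm a (a c - b^2). *)
  have := @gm_pos _ _ M p (- b *: e i0 + a *: e i1).
  rewrite !(gmDl, gmDr, gmZl, gmZr) !gE -/a -/b -/c (gS i1 i0) -/b => H.
  rewrite -(pmulr_rgt0 _ a0); apply: lt_le_trans (H _) _.
    by apply: (e_neq0 _ i1); rewrite !mxE /= mulr0 add0r mulr1 gt_eqF.
  by rewrite le_eqVlt; apply/orP; left; apply/eqP; ring.
rewrite det3 (gS i1 i0) (gS i2 i0) (gS i2 i1) -/a -/b -/c -/f -/g -/h.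
rewrite -(pmulr_rgt0 _ D2).
(* The last row of cofactors is orthogonal to e i0 and e i1, and its squared
   norm is the determinant times the leading 2 x 2 minor. *)
have := @gm_pos _ _ M p ((b * g - c * f) *: e i0 + (b * f - a * g) *: e i1 +
                         (a * c - b ^+ 2) *: e i2).
rewrite !(gmDl, gmDr, gmZl, gmZr) !gE (gS i1 i0) (gS i2 i0) (gS i2 i1).
rewrite -/a -/b -/c -/f -/g -/h => H.
apply: lt_le_trans (H _) _.
  by apply: (e_neq0 _ i2); rewrite !mxE /= !mulr0 !add0r mulr1 gt_eqF.
by rewrite le_eqVlt; apply/orP; left; apply/eqP; ring.
Qed.

(** The product of two volumes is the determinant of the matrix of inner
    products.  All decompositions in orthogonal bases used below are instances
    of this identity, which avoids computing with the bases themselves. *)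
Lemma vol3_mul u v w x y z :
  vol3 p u v w * vol3 p x y z =
    gm p u x * (gm p v y * gm p w z - gm p v z * gm p w y)
  - gm p u y * (gm p v x * gm p w z - gm p v z * gm p w x)
  + gm p u z * (gm p v x * gm p w y - gm p v y * gm p w x).
Proof.
have [U0 U1 U2] := row_rows3 u v w; have [X0 X1 X2] := row_rows3 x y z.
rewrite !vol3E mulrACA -expr2 sqr_sqrtr; last exact/ltW/gram_det_gt0.
transitivity (\det (rows3 u v w *m gram p *m (rows3 x y z)^T)).
  by rewrite !det_mulmx det_tr; ring.
by rewrite det3 !rows3_gram U0 U1 U2 X0 X1 X2.
Qed.

Lemma vol3_coord u v w : vol3 p u v w = Num.sqrt (\det (gram p)) *
  (u 0 i0 * (v 0 i1 * w 0 i2 - v 0 i2 * w 0 i1)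
  - u 0 i1 * (v 0 i0 * w 0 i2 - v 0 i2 * w 0 i0)
  + u 0 i2 * (v 0 i0 * w 0 i1 - v 0 i1 * w 0 i0)).
Proof.
have [U0 U1 U2] := row_rows3 u v w.
have E i j : rows3 u v w i j = row i (rows3 u v w) 0 j by rewrite [RHS]mxE.
by rewrite vol3E (det3 (rows3 u v w)) !E U0 U1 U2.
Qed.

Lemma vol3_swap23 u v w : vol3 p u w v = - vol3 p u v w.
Proof. by rewrite !vol3_coord; ring. Qed.

Lemma vol3_linear u v : linear (fun w => vol3 p u v w : R^o).
Proof. by move=> a x y; rewrite !vol3_coord !mxE /GRing.scale /=; ring. Qed.

Lemma vol3Dr u v w z : vol3 p u v (w + z) = vol3 p u v w + vol3 p u v z.
Proof. by rewrite !vol3_coord !mxE; ring. Qed.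

Lemma vol3Zr a u v w : vol3 p u v (a *: w) = a * vol3 p u v w.
Proof. by rewrite !vol3_coord !mxE; ring. Qed.

Lemma vol3Nr u v w : vol3 p u v (- w) = - vol3 p u v w.
Proof. by rewrite !vol3_coord !mxE; ring. Qed.

Lemma vol3_xx u v : vol3 p u v v = 0.
Proof. by rewrite vol3_coord; ring. Qed.

Lemma gram_unit : gram p \in unitmx.
Proof. by rewrite unitmxE unitfE gt_eqF // gram_det_gt0. Qed.

Lemma gm_cross u v w : gm p (cross p u v) w = vol3 p u v w.
Proof.
rewrite gmE /cross mulmxKV ?gram_unit // [RHS](linear_coord _ (vol3_linear u
  v)).
by rewrite mxE; apply: eq_bigr => k _; rewrite !mxE mulrC.
Qed.

(** In terms of J x = N /\ x: z has components <z, N> and <z, J x> / |x|^2 along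
    N and J x, and y only sees the second one. *)
Lemma vol3_unit_normal N x y z : gm p N N = 1 -> gm p x N = 0 -> gm p y N = 0 ->
  gm p z x = 0 -> vol3 p N x z * vol3 p N x y = gm p x x * gm p z y.
Proof.
move=> N1 xN yN zx; have Nx := xN; have Ny := yN; rewrite gm_sym in Nx.
by rewrite gm_sym in Ny; rewrite vol3_mul N1 xN Nx Ny zx; ring.
Qed.

(** For y = x this says that the component of Z along J x has length
    sqrt (1 - <N, Z>^2). *)
Lemma vol3_two_normals N Z x y : gm p N N = 1 -> gm p Z Z = 1 ->
  gm p x N = 0 -> gm p x Z = 0 -> gm p y N = 0 ->
  vol3 p N y Z * vol3 p N x Z = gm p y x * (1 - gm p N Z ^+ 2).
Proof.
move=> N1 Z1 xN xZ yN; have Nx := xN; have Zx := xZ.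
rewrite gm_sym in Nx; rewrite gm_sym in Zx.
by rewrite vol3_mul (gm_sym p Z N) N1 Z1 Nx Zx yN; ring.
Qed.

(** y minus its projection w on x is orthogonal to N and x, so the squared
    volume of N, x, w is |x|^2 |w|^2. *)
Lemma tangent_collinear N x y : gm p N N = 1 -> x != 0 -> gm p x N = 0 ->
  gm p y N = 0 -> vol3 p N x y = 0 -> y = (gm p y x / gm p x x) *: x.
Proof.
move=> N1 x0 xN yN V0; have xx : gm p x x != 0 by rewrite gt_eqF // gm_pos.
pose w := y - (gm p y x / gm p x x) *: x.
have wN : gm p w N = 0 by rewrite /w gmBl gmZl xN yN; ring.
have wx : gm p w x = 0 by rewrite /w gmBl gmZl divfK // subrr.
have : vol3 p N x w * vol3 p N x w = gm p x x * gm p w w.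
  exact: vol3_unit_normal.
have -> : vol3 p N x w = 0.
  by rewrite /w -scaleNr vol3Dr vol3Zr V0 vol3_xx mulr0 addr0.
rewrite mulr0 => /esym/eqP; rewrite mulf_eq0 (negPf xx) /= => ww.
apply/eqP; rewrite -subr_eq0 -/w; apply: contraTT ww => w0.
by rewrite gt_eqF // gm_pos.
Qed.

End Volume.

(** * Differentiation along a curve *)

Section CurveCalculus.
Variable R : realType.

Lemma derive1_comp_curve (V W : normedModType R) (f : R -> V) (g : V -> W) t :
  differentiable f t -> differentiable g (f t) ->
  differentiable (fun s => g (f s)) t /\
  derive1 (fun s => g (f s)) t = 'D_(derive1 f t) g (f t).
Proof. by move=> df dg; rewrite !derive1E; exact: comp_diff. Qed.

(** Leibniz rule in which the derivative of the operator is taken on the frozen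
    vector u t; in this form it matches the correction term in the
    transformation law of Christoffel symbols. *)
Lemma derive1_linear_family (W : normedModType R) n (U : set R)
    (L : R -> 'rV[R]_n -> W) (u : R -> 'rV[R]_n) t :
  open U -> U t -> (forall s, U s -> linear (L s)) ->
  (forall w, differentiable (fun s => L s w) t) -> differentiable u t ->
  differentiable (fun s => L s (u s)) t /\
  derive1 (fun s => L s (u s)) t =
    derive1 (fun s => L s (u t)) t + L t (derive1 u t).
Proof.
move=> oU Ut linL dL du.
pose h j s := u s 0 j *: L s (delta_mx 0 j).
pose k j s := u t 0 j *: L s (delta_mx 0 j).
have dh j : differentiable (h j) t /\
    'D_1 (h j) t = 'D_1 u t 0 j *: L t (delta_mx 0 j) +
                   u t 0 j *: 'D_1 (fun s => L s (delta_mx 0 j)) t.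
  have [dc <-] := coord_diff (1 : R^o) j du.
  exact: (scale_diff (1 : R^o) dc (dL (delta_mx 0 j))).
have dk j : differentiable (k j) t by apply: differentiableZ; exact: dL.
have Eh : {near t, \sum_j h j =1 fun s => L s (u s)}.
  apply: (open_near oU Ut) => s Us.
  by rewrite fct_sumE [RHS]linear_coord //; exact: linL.
have Ek : {near t, \sum_j k j =1 fun s => L s (u t)}.
  apply: (open_near oU Ut) => s Us.
  by rewrite fct_sumE [RHS]linear_coord //; exact: linL.
have dsh : differentiable (\sum_j h j) t.
  by apply: differentiable_sum => j; exact: (dh j).1.
split; first exact: near_differentiable Eh dsh.
rewrite !derive1E -(near_eq_derive _ Eh) -(near_eq_derive _ Ek).
rewrite !derive_sum; first last.
- by move=> j; apply: diff_derivable; exact: (dh j).1.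
- by move=> j; apply: diff_derivable; exact: dk.
rewrite (linear_coord ('D_1 u t) (linL _ Ut)) -big_split /=.
apply: eq_bigr => j _; rewrite (dh j).2 addrC; congr (_ + _).
by rewrite [RHS]deriveZ //; apply: diff_derivable; exact: dL.
Qed.

End CurveCalculus.

Section Charts.
Variables (R : realType) (n : nat) (M : manifold R n).
Implicit Types (c d e : chart R n M) (p : M).

Lemma cinvK c p : atlas c -> cdom c p -> cinv c (cmap c p) = p.
Proof. by move=> /(@atlas_chart _ _ M) [_ _ K _ _] /K. Qed.

(** The set is the part of the image of the chart that the inverse, continuous
    there, sends into A. *)
Lemma chart_image_open c (A : set M) :
  atlas c -> open A -> open (cmap c @` (cdom c `&` A)).
Proof.
move=> /(@atlas_chart _ _ M) [oc oi K _ Kc] oA.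
have -> : cmap c @` (cdom c `&` A) = cimg c `&` (cinv c @^-1` A).
  apply/seteqP; split=> [x [p [cp Ap] <-]|x [[p cp <-]]].
    by split; [exists p|rewrite /preimage /= K].
  by rewrite /preimage /= K // => Ap; exists p.
rewrite openE => x [ix Ax]; apply: filterI;
  first exact: (open_nbhs_nbhs (conj oi ix)).
by apply: (Kc x ix); exact: (open_nbhs_nbhs (conj oA Ax)).
Qed.

Lemma cdom_open c : atlas c -> open (cdom c).
Proof. by move=> /(@atlas_chart _ _ M) []. Qed.

Lemma transition_diff c d p : atlas c -> atlas d -> cdom c p -> cdom d p ->
  differentiable (transition c d) (cmap c p).
Proof.
by move=> ac ad cp dp; have [+ _] := atlas_smooth ac ad 1; apply; exists p.
Qed.

Lemma transition_pt c d p : atlas c -> cdom c p ->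
  transition c d (cmap c p) = cmap d p.
Proof. by move=> ac cp; rewrite /transition cinvK. Qed.

Lemma chart_change_linear c d p : atlas c -> atlas d -> cdom c p -> cdom d p ->
  linear (chart_change p c d).
Proof. by move=> *; apply: derive_linear; exact: transition_diff. Qed.

Lemma chart_change_id c p u : atlas c -> cdom c p -> chart_change p c c u = u.
Proof.
move=> ac cp; rewrite -[RHS](derive_id (cmap c p)).
have oD := chart_image_open ac (cdom_open ac).
apply: (near_eq_derive _ (open_near oD _ _)); first by exists p.
by move=> _ [q [cq _] <-]; rewrite transition_pt.
Qed.

(** Chain rule for the transition maps; it makes components in different charts
    describe the same tangent vector. *)
Lemma chart_change_trans c d e p u : atlas c -> atlas d -> atlas e ->
  cdom c p -> cdom d p -> cdom e p ->
  chart_change p d e (chart_change p c d u) = chart_change p c e u.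
Proof.
move=> ac ad ae cp dp ep.
have oD := chart_image_open ac (openI (cdom_open ad) (cdom_open ae)).
have := @comp_diff _ _ _ _ (transition c d) (transition d e) (cmap c p) u.
rewrite transition_pt // => /(_ (transition_diff ac ad cp dp)) [].
  exact: transition_diff.
rewrite /chart_change => _ <-.
apply: (near_eq_derive _ (open_near oD _ _)); first by exists p.
by move=> _ [q [cq [dq _]] <-]; rewrite !transition_pt.
Qed.

Lemma from_toK d p u : atlas d -> cdom d p ->
  from_chart d p (to_chart d p u) = u.
Proof.
move=> ad dp; have a0 := chart_at_atlas p; have m0 := mem_chart_at p.
by rewrite /from_chart /to_chart chart_change_trans // chart_change_id.
Qed.

Section Curve.
Variables (I : set R) (g : R -> M).
Hypotheses (oI : open I) (sg : smooth_curve I g).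

Lemma curve_preimage_open (A : set M) : open A -> open (I `&` g @^-1` A).
Proof.
move=> oA; rewrite openE => t [It At]; apply: filterI.
  exact: (open_nbhs_nbhs (conj oI It)).
by apply: (sg.1 t It); exact: (open_nbhs_nbhs (conj oA At)).
Qed.

Lemma curve_diff d t : atlas d -> I t -> cdom d (g t) ->
  differentiable (fun s => cmap d (g s)) t.
Proof. by move=> ad It dt; have [+ _] := sg.2 d ad 1; apply. Qed.

Lemma curve_change c d t : atlas c -> atlas d -> I t ->
  cdom c (g t) -> cdom d (g t) ->
  chart_change (g t) c d (derive1 (fun s => cmap c (g s)) t) =
  derive1 (fun s => cmap d (g s)) t.
Proof.
move=> ac ad It ct dt.
have [_] := derive1_comp_curve (curve_diff ac It ct) (transition_diff ac ad ct
  dt).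
rewrite /chart_change => <-; rewrite !derive1E.
have oD := curve_preimage_open (cdom_open ac).
apply: (near_eq_derive _ (open_near oD _ _)); first by [].
by move=> s [Is cs]; rewrite transition_pt.
Qed.

Lemma velocity_chart d t : atlas d -> I t -> cdom d (g t) ->
  to_chart d (g t) (velocity g t) = derive1 (fun s => cmap d (g s)) t.
Proof.
move=> ad It dt; apply: curve_change => //; first exact: chart_at_atlas.
exact: mem_chart_at.
Qed.

End Curve.
End Charts.

(** * Fields along a curve and their covariant derivative *)

Section Along.
Variables (R : realType) (n : nat) (I : set R).
Hypothesis oI : open I.

(** A field along g gives, at each time, components in the preferred chart at
    g s.  This chart jumps with s, hence smoothness is tested in fixed
    charts. *)
Definition smooth_along (M : manifold R n) (g : R -> M) (V : R -> 'rV[R]_n) :=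
  forall d, atlas d -> @smooth_on R R^o 'rV[R]_n (I `&` g @^-1` cdom d)
    (fun s => to_chart d (g s) (V s)).

Section Map.
Variables (m : nat) (S : manifold R m) (M : manifold R n) (f : S -> M).
Variables (c : R -> S) (g : R -> M).
Hypotheses (sf : smooth_map f) (sc : smooth_curve I c).
Hypothesis fc : forall t, I t -> f (c t) = g t.

Lemma differential_velocity t : I t ->
  differential f (c t) (velocity c t) = velocity g t.
Proof.
move=> It; rewrite /differential /velocity -(fc It).
set b := chart_at (c t); set d := chart_at (f (c t)).
have ab : atlas b := chart_at_atlas (c t).
have ad : atlas d := chart_at_atlas (f (c t)).
have bt : cdom b (c t) := mem_chart_at (c t).
have dt : cdom d (f (c t)) := mem_chart_at (f (c t)).
have dF : differentiable (fun x => cmap d (f (cinv b x))) (cmap b (c t)).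
  by have [+ _] := sf.2 b d ab ad 1; apply; exists (c t).
have [_ <-] := derive1_comp_curve (curve_diff sc ab It bt) dF.
rewrite !derive1E.
have oD := curve_preimage_open oI sc (cdom_open ab).
apply: (near_eq_derive _ (open_near oD _ _)); first by [].
by move=> s [Is bs]; rewrite (cinvK ab bs) (fc Is).
Qed.

Lemma field_repr_diff V t : smooth_field f V -> I t ->
  let b := chart_at (c t) in let d := chart_at (f (c t)) in
  derive1 (fun s => to_chart d (g s) (V (c s))) t =
  'D_(velocity c t) (fun x => to_chart d (f (cinv b x)) (V (cinv b x)))
    (cmap b (c t)).
Proof.
move=> sV It b d.
have ab : atlas b := chart_at_atlas (c t).
have ad : atlas d := chart_at_atlas (f (c t)).
have bt : cdom b (c t) := mem_chart_at (c t).
have dt : cdom d (f (c t)) := mem_chart_at (f (c t)).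
have dF : differentiable
    (fun x => to_chart d (f (cinv b x)) (V (cinv b x))) (cmap b (c t)).
  by have [+ _] := sV b d ab ad 1; apply; exists (c t).
have [_ <-] := derive1_comp_curve (curve_diff sc ab It bt) dF.
rewrite !derive1E.
have oD := curve_preimage_open oI sc (cdom_open ab).
apply: (near_eq_derive _ (open_near oD _ _)); first by [].
by move=> s [Is bs]; rewrite (cinvK ab bs) (fc Is).
Qed.

Lemma field_along V : smooth_field f V -> smooth_along g (fun s => V (c s)).
Proof.
move=> sV d ad k; apply: Ck_local => t [It dt].
set b := chart_at (c t).
have ab : atlas b := chart_at_atlas (c t).
have bt : cdom b (c t) := mem_chart_at (c t).
pose O := cdom b `&` f @^-1` cdom d.
have oO : open O.
  apply: openI (cdom_open ab) _; apply: open_comp (cdom_open ad).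
  by move=> x _; exact: sf.1.
have oU := curve_preimage_open oI sc oO.
exists (I `&` c @^-1` O).
  by split=> //; split=> //; rewrite /preimage /= fc.
have cb : @Ck R R^o 'rV[R]_m k (I `&` c @^-1` O) (fun s => cmap b (c s)).
  by apply: Ck_sub (sc.2 b ab k) => s [Is [bs _]].
have UO s : (I `&` c @^-1` O) s -> (cmap b @` O) (cmap b (c s)).
  by move=> [_ Os]; exists (c s).
apply: (Ck_ext oU) (Ck_comp oU UO cb (sV b d ab ad k)) => s [Is [bs ds]].
by rewrite (cinvK ab bs) (fc Is).
Qed.

End Map.

Section Covariant.
Variables (M : riemannian R n) (g : R -> M).
Hypothesis sg : smooth_curve I g.
Implicit Types (c d : chart R n M) (V W : R -> 'rV[R]_n).

(** Coordinate expression, in the chart d, of the covariant derivative of V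
    along g. *)
Definition cov d V t : 'rV[R]_n :=
  derive1 (fun s => to_chart d (g s) (V s)) t +
  christoffel d (cmap d (g t)) (derive1 (fun s => cmap d (g s)) t)
    (to_chart d (g t) (V t)).

(** The vector of [cov], by its components in the preferred chart at g t. *)
Definition nabla_curve V t := cov (chart_at (g t)) V t.

Lemma along_diff V d t : smooth_along g V -> atlas d -> I t -> cdom d (g t) ->
  differentiable (fun s => to_chart d (g s) (V s)) t.
Proof. by move=> sV ad It dt; have [+ _] := sV d ad 1; apply. Qed.

(** Differentiating the change of components produces a second derivative of the
    transition map, which the transformation law of the Christoffel symbols
    cancels. *)
Lemma cov_change c d V t : smooth_along g V -> atlas c -> atlas d -> I t ->
  cdom c (g t) -> cdom d (g t) ->
  chart_change (g t) c d (cov c V t) = cov d V t.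
Proof.
move=> sV ac ad It ct dt.
pose x s := cmap c (g s); pose w s := to_chart c (g s) (V s).
have dx : differentiable x t := curve_diff sg ac It ct.
have dw : differentiable w t := along_diff sV ac It ct.
have oD := curve_preimage_open oI sg (openI (cdom_open ac) (cdom_open ad)).
have lin s : (I `&` g @^-1` (cdom c `&` cdom d)) s ->
    linear (chart_change (g s) c d).
  by move=> [Is [cs ds]]; exact: chart_change_linear.
have dD u : differentiable (fun y => 'D_u (transition c d) y) (x t).
  have [_ H] := atlas_smooth ac ad 2.
  by have [+ _] := H u; apply; exists (g t).
have dL u : differentiable (fun s => chart_change (g s) c d u) t.
  exact: (derive1_comp_curve dx (dD u)).1.
have [_ E] := derive1_linear_family oD (conj It (conj ct dt)) lin dL dw.
have E1 : derive1 (fun s => to_chart d (g s) (V s)) t =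
    derive1 (fun s => chart_change (g s) c d (w s)) t.
  rewrite !derive1E; apply: (near_eq_derive _ (open_near oD _ _)); first by [].
  move=> s [Is [cs ds]].
  exact: (esym (chart_change_trans (V s) (chart_at_atlas (g s)) ac ad
    (mem_chart_at (g s)) cs ds)).
have E2 : to_chart d (g t) (V t) = chart_change (g t) c d (w t).
  exact: (esym (chart_change_trans (V t) (chart_at_atlas (g t)) ac ad
    (mem_chart_at (g t)) ct dt)).
have E3 : derive1 (fun s => chart_change (g s) c d (w t)) t =
    'D_(derive1 x t) (fun y => 'D_(w t) (transition c d) y) (x t).
  exact: (derive1_comp_curve dx (dD (w t))).2.
rewrite [RHS]/cov E1 E E2 E3 -(curve_change oI sg ac ad It ct dt).
rewrite (christoffel_change ac ad ct dt) -/(x t) /cov -/(x t) -/(w t).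
have cancel (A B C : 'rV[R]_n) : A + B + (C - A) = B + C.
  by rewrite addrC addrA subrK addrC.
rewrite cancel.
have := chart_change_linear ac ad ct dt 1 (derive1 w t)
  (christoffel c (x t) (derive1 x t) (w t)).
by rewrite !scale1r.
Qed.

Lemma nabla_curve_chart V d t : smooth_along g V -> atlas d -> I t ->
  cdom d (g t) -> to_chart d (g t) (nabla_curve V t) = cov d V t.
Proof.
move=> sV ad It dt; apply: cov_change => //; first exact: chart_at_atlas.
exact: mem_chart_at.
Qed.

Lemma Ck_along d k : atlas d ->
  @Ck R R^o 'rV[R]_n k (I `&` g @^-1` cdom d) (fun s => cmap d (g s)).
Proof. by move=> ad; exact: sg.2. Qed.

Lemma Ck_derive1 (W : normedModType R) k (U : set R) (h : R -> W) :
  @Ck R R^o W k.+1 U h -> @Ck R R^o W k U (derive1 h).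
Proof.
by move=> [_ /(_ 1)]; rewrite (_ : derive1 h = 'D_1 h) //; apply/funext => s;
  exact: derive1E.
Qed.

Lemma velocity_along : smooth_along g (velocity g).
Proof.
move=> d ad k.
have oU := curve_preimage_open oI sg (cdom_open ad).
apply: (Ck_ext oU) (Ck_derive1 (Ck_along k.+1 ad)) => s [Is ds].
by rewrite (velocity_chart oI sg).
Qed.

(** A covariant derivative along a surface, in the direction of the velocity of
    a curve, only depends on the values of the field on that curve. *)
Lemma nabla_along_curve (m : nat) (S : manifold R m) (f : S -> M) (c : R -> S)
    (V : S -> 'rV[R]_n) t : smooth_map f -> smooth_curve I c ->
  (forall t, I t -> f (c t) = g t) -> smooth_field f V -> I t ->
  nabla_along f V (c t) (velocity c t) = nabla_curve (fun s => V (c s)) t.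
Proof.
move=> sf sc fc sV It.
rewrite /nabla_along /nabla_curve /cov -(field_repr_diff sc fc sV It).
rewrite (differential_velocity sf sc fc It) fc //;
  congr (_ + christoffel _ _ _ _).
by rewrite /to_chart chart_change_id //;
  [exact: chart_at_atlas|exact: mem_chart_at].
Qed.

Lemma nabla_curve_along V : smooth_along g V -> smooth_along g (nabla_curve V).
Proof.
move=> sV d ad k.
have oU := curve_preimage_open oI sg (cdom_open ad).
have img s : (I `&` g @^-1` cdom d) s -> cimg d (cmap d (g s)).
  by move=> [_ ds]; exists (g s).
have H := Ck_derive1 (sV d ad k.+1).
apply: (@Ck_ext _ _ _ _ _ (cov d V)) => //.
  by move=> s [Is ds]; rewrite nabla_curve_chart.
apply: Ck_add => //.
apply: (@Ck_linear_family _ _ _ _ _ n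
  (fun s w => christoffel d (cmap d (g s)) (derive1 (fun s =>
    cmap d (g s)) s) w)).
- by [].
- by move=> s Us a u v; apply: christoffel_linearr => //; exact: img.
- move=> j; apply: (@Ck_linear_family _ _ _ _ _ n
    (fun s w => christoffel d (cmap d (g s)) w (delta_mx 0 j))).
  + by [].
  + by move=> s Us a u v; apply: christoffel_linearl => //; exact: img.
  + move=> i; have sG := christoffel_smooth ad (delta_mx 0 i) (delta_mx 0 j).
    exact: Ck_comp oU img (Ck_along k ad) (sG k).
  + exact: Ck_derive1 (Ck_along k.+1 ad).
- exact: sV.
Qed.

Lemma metric_chart d p u v : atlas d -> cdom d p ->
  metric_in d (cmap d p) (to_chart d p u) (to_chart d p v) = gm p u v.
Proof. by move=> ad dp; rewrite /metric_in cinvK // !from_toK. Qed.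

Lemma metric_linearl d p w : atlas d -> cdom d p ->
  linear (fun u => metric_in d (cmap d p) u w : R^o).
Proof.
move=> ad dp a u v; rewrite /metric_in cinvK // /from_chart.
rewrite (chart_change_linear _ _ dp (mem_chart_at p)) //;
  last exact: chart_at_atlas.
by rewrite gm_linear.
Qed.

Lemma metric_sym d p u v : metric_in d p u v = metric_in d p v u.
Proof. by rewrite /metric_in gm_sym. Qed.

Lemma metric_linearr d p w : atlas d -> cdom d p ->
  linear (fun u => metric_in d (cmap d p) w u : R^o).
Proof. by move=> ad dp a u v; rewrite !(metric_sym _ _ w);
  exact: metric_linearl. Qed.

Lemma metricDl d p u v w : atlas d -> cdom d p ->
  metric_in d (cmap d p) (u + v) w =
  metric_in d (cmap d p) u w + metric_in d (cmap d p) v w.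
Proof.
by move=> ad dp; have := metric_linearl w ad dp 1 u v; rewrite /= !scale1r.
Qed.

Lemma metricDr d p w u v : atlas d -> cdom d p ->
  metric_in d (cmap d p) w (u + v) =
  metric_in d (cmap d p) w u + metric_in d (cmap d p) w v.
Proof.
by move=> ad dp; have := metric_linearr w ad dp 1 u v; rewrite /= !scale1r.
Qed.

Lemma gm_along V W : smooth_along g V -> smooth_along g W ->
  @smooth_on R R^o R^o I (fun s => gm (g s) (V s) (W s)).
Proof.
move=> sV sW k; apply: Ck_local => t It.
set d := chart_at (g t); have ad : atlas d := chart_at_atlas (g t).
have dt : cdom d (g t) := mem_chart_at (g t).
have oU := curve_preimage_open oI sg (cdom_open ad).
have img s : (I `&` g @^-1` cdom d) s -> cimg d (cmap d (g s)).
  by move=> [_ ds]; exists (g s).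
exists (I `&` g @^-1` cdom d) => //.
apply: (@Ck_ext _ _ _ _ _ (fun s => metric_in d (cmap d (g s))
  (to_chart d (g s) (V s)) (to_chart d (g s) (W s)) : R^o)) => //.
  by move=> s [Is ds]; exact: metric_chart.
apply: (@Ck_linear_family _ R^o _ _ _ n (fun s w =>
  metric_in d (cmap d (g s)) (to_chart d (g s) (V s)) w)) => //.
- by move=> s [Is ds]; exact: metric_linearr.
- move=> j; apply: (@Ck_linear_family _ R^o _ _ _ n (fun s w =>
    metric_in d (cmap d (g s)) w (delta_mx 0 j))) => //.
  + by move=> s [Is ds]; exact: metric_linearl.
  + move=> i; have sG := gm_smooth ad (delta_mx 0 i) (delta_mx 0 j).
    exact: Ck_comp oU img (Ck_along k ad) (sG k).
  + exact: sV.
- exact: sW.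
Qed.

(** [christoffel_metric] gives the derivative of the metric coefficients, and
    the two Leibniz rules turn its terms into covariant derivatives. *)
Lemma derive1_gm V W t : smooth_along g V -> smooth_along g W -> I t ->
  derive1 (fun s => gm (g s) (V s) (W s) : R^o) t =
  gm (g t) (nabla_curve V t) (W t) + gm (g t) (V t) (nabla_curve W t).
Proof.
move=> sV sW It.
set d := chart_at (g t); have ad : atlas d := chart_at_atlas (g t).
have dt : cdom d (g t) := mem_chart_at (g t).
pose x s := cmap d (g s).
pose v s := to_chart d (g s) (V s); pose w s := to_chart d (g s) (W s).
have dx : differentiable x t := curve_diff sg ad It dt.
have dv : differentiable v t := along_diff sV ad It dt.
have dw : differentiable w t := along_diff sW ad It dt.
have oU := curve_preimage_open oI sg (cdom_open ad).
have Ut : (I `&` g @^-1` cdom d) t by [].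
have dg a b : differentiable (fun y => metric_in d y a b : R^o) (x t).
  by have [+ _] := gm_smooth ad a b 1; apply; exists (g t).
have dgx a b := derive1_comp_curve dx (dg a b).
have [] := @derive1_linear_family R R^o n (I `&` g @^-1` cdom d)
  (fun s a => metric_in d (x s) a (w t)) v t oU Ut.
- by move=> s [Is ds]; exact: metric_linearl.
- by move=> a; exact: (dgx a (w t)).1.
- exact: dv.
move=> _ E1.
have dvb b : differentiable (fun s => metric_in d (x s) (v s) b : R^o) t.
  have [] // := @derive1_linear_family R R^o n (I `&` g @^-1` cdom d)
    (fun s a => metric_in d (x s) a b) v t oU Ut.
  - by move=> s [Is ds]; exact: metric_linearl.
  - by move=> a; exact: (dgx a b).1.
have [] := @derive1_linear_family R R^o n (I `&` g @^-1` cdom d)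
  (fun s a => metric_in d (x s) (v s) a) w t oU Ut.
- by move=> s [Is ds]; exact: metric_linearr.
- exact: dvb.
- exact: dw.
move=> _ E2.
have -> : derive1 (fun s => gm (g s) (V s) (W s) : R^o) t =
    derive1 (fun s => metric_in d (x s) (v s) (w s) : R^o) t.
  rewrite !derive1E; apply: (near_eq_derive _ (open_near oU _ _)); first by [].
  by move=> s [Is ds]; rewrite metric_chart.
rewrite E2 E1 (dgx _ _).2.
have xt : cimg d (x t) by exists (g t).
rewrite (christoffel_metric ad xt).
have EV := congr1 (fun z => metric_in d (x t) z (w t))
  (nabla_curve_chart sV ad It dt).
have EW := congr1 (fun z => metric_in d (x t) (v t) z)
  (nabla_curve_chart sW ad It dt).
rewrite (etrans (esym (metric_chart (nabla_curve V t) (W t) ad dt)) EV).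
rewrite (etrans (esym (metric_chart (V t) (nabla_curve W t) ad dt)) EW).
rewrite /cov -/(x t) -/(v t) -/(w t) (metricDl _ _ (w t) ad dt).
rewrite (metricDr (v t) _ _ ad dt).
have reorder (a b a' b' : R) : a + b + a' + b' = a' + a + (b' + b) by ring.
exact: reorder.
Qed.

Lemma gm_const_derive V W k t : smooth_along g V -> smooth_along g W -> I t ->
  (forall s, I s -> gm (g s) (V s) (W s) = k) ->
  gm (g t) (nabla_curve V t) (W t) + gm (g t) (V t) (nabla_curve W t) = 0.
Proof.
move=> sV sW It H; rewrite -derive1_gm // derive1E.
rewrite (near_eq_derive _ (open_near (g := fun=> k) oI It H)).
exact: derive_cst.
Qed.

End Covariant.
End Along.

(** * Two unit normals to a common tangent vector *)

Section TwoPlanes.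
Variables (R : realType) (M : riemannian R 3) (p : M).
Implicit Types N Z x y : 'rV[R]_3.

Lemma normals_swap N Z x : vol3 p Z x N = - vol3 p N x Z.
Proof. by rewrite !vol3_coord; ring. Qed.

(** If the volume vanished, N and Z would be parallel by [vol3_two_normals],
    and the planes orthogonal to them would not span the space. *)
Lemma transversal_vol3 N Z x : gm p N N = 1 -> gm p Z Z = 1 -> x != 0 ->
  gm p x N = 0 -> gm p x Z = 0 ->
  (forall w, exists u v, [/\ w = u + v, gm p N u = 0 & gm p Z v = 0]) ->
  vol3 p N x Z != 0.
Proof.
move=> N1 Z1 x0 xN xZ tr; have xx : gm p x x != 0 by rewrite gt_eqF // gm_pos.
set k := gm p N Z; have k1 : 1 - k ^+ 2 != 0.
  apply/negP => /eqP k1; have NkZ : N - k *: Z = 0.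
    apply/eqP; apply: contraT => H; have := gm_pos p H.
    rewrite !(gmBl, gmDr, gmNr, gmZl, gmZr) N1 Z1 (gm_sym p Z N) -/k.
    by rewrite [X in 0 < X](_ : _ = 1 - k ^+ 2) ?k1 ?ltxx //; ring.
  have [u [v [Nuv Nu Zv]]] := tr N.
  have /eqP := N1; rewrite {2}Nuv gmDr Nu add0r.
  have -> : N = k *: Z by apply/eqP; rewrite -subr_eq0 NkZ.
  by rewrite gmZl Zv mulr0 eq_sym oner_eq0.
have /eqP := vol3_two_normals N1 Z1 xN xZ xN; rewrite -/k.
apply: contraTneq => ->; rewrite mulr0 eq_sym mulf_eq0.
by rewrite (negPf xx) (negPf k1).
Qed.

(** Here y and z are A_1 X and A_2 X, and the last hypothesis is the derivative
    of <N, Z> = const.  By [vol3_unit_normal] both sides, multiplied by the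
    volume of N, x, Z, are up to sign |x|^2 times the inner product with the
    other normal. *)
Lemma torsion_eq N Z x y z : gm p N N = 1 -> gm p Z Z = 1 ->
  gm p x N = 0 -> gm p x Z = 0 -> vol3 p N x Z != 0 ->
  gm p y N = 0 -> gm p z Z = 0 -> gm p y Z + gm p N z = 0 ->
  vol3 p N x y = vol3 p Z x z.
Proof.
move=> N1 Z1 xN xZ a0 yN zZ yz; apply: (mulfI a0); apply/eqP.
rewrite (vol3_unit_normal N1 xN yN); last by rewrite gm_sym.
have := vol3_unit_normal Z1 xZ zZ (z := N).
rewrite gm_sym normals_swap mulNr => /(_ xN) /eqP; rewrite eqr_oppLR => /eqP ->.
by rewrite -mulrN (gm_sym p Z) -subr_eq0 -mulrBr opprK yz mulr0.
Qed.

(** Z is a combination of N and J x, the vector J y is orthogonal to N, and J is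
    an isometry of the plane orthogonal to N. *)
Lemma cross_inner N Z x y : gm p N N = 1 -> gm p Z Z = 1 ->
  gm p x N = 0 -> gm p x Z = 0 -> vol3 p N x Z != 0 -> gm p y N = 0 ->
  vol3 p N y Z * gm p x x = gm p y x * vol3 p N x Z.
Proof.
move=> N1 Z1 xN xZ a0 yN; apply: (mulIf a0).
rewrite mulrAC (vol3_two_normals N1 Z1 xN xZ yN) -mulrA [_ * gm p x x]mulrC.
by rewrite -(vol3_two_normals N1 Z1 xN xZ xN) mulrA.
Qed.

(** Each factor of the expression in hypothesis b) is, up to the component of Z
    along J x, an inner product with x or J x. *)
Lemma condition_product N Z x y : gm p N N = 1 -> gm p Z Z = 1 ->
  gm p x N = 0 -> gm p x Z = 0 -> vol3 p N x Z != 0 -> gm p y N = 0 ->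
  (gm p y Z * gm p (cross p N y) Z) * gm p x x ^+ 2 =
  vol3 p N x Z ^+ 2 * (gm p y x * vol3 p N x y).
Proof.
move=> N1 Z1 xN xZ a0 yN.
have Zx : gm p Z x = 0 by rewrite gm_sym.
have := cross_inner N1 Z1 xN xZ a0 yN.
have := vol3_unit_normal N1 xN yN Zx.
rewrite gm_cross (gm_sym p Z y) expr2 => H1 H2.
transitivity ((gm p x x * gm p y Z) * (vol3 p N y Z * gm p x x)); first by ring.
by rewrite -H1 H2; ring.
Qed.

(** With r = <y, x> and q = <y, J x>, passing from y to w multiplies r + i q by
    a + i b.  The square of this complex number has twice the product as its
    imaginary part, and it is multiplied by (a + i b)^2, which is real when
    a b = 0. *)
Lemma rotated_product N Z x y a b : gm p N N = 1 -> gm p Z Z = 1 -> x != 0 ->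
  gm p x N = 0 -> gm p x Z = 0 -> vol3 p N x Z != 0 -> gm p y N = 0 ->
  a * b = 0 ->
  let w := a *: y + b *: cross p N y in
  gm p w x * vol3 p N x w = (a ^+ 2 - b ^+ 2) * (gm p y x * vol3 p N x y).
Proof.
move=> N1 Z1 x0 xN xZ a0 yN ab w.
have xx : gm p x x != 0 by rewrite gt_eqF // gm_pos.
have Zx : gm p Z x = 0 by rewrite gm_sym.
have JyN : gm p (cross p N y) N = 0 by rewrite gm_cross vol3_coord; ring.
have Jyx : gm p (cross p N y) x = - vol3 p N x y by rewrite gm_cross
  vol3_swap23.
have xJy : vol3 p N x (cross p N y) = gm p y x.
  apply: (mulfI a0); rewrite (vol3_unit_normal N1 xN JyN Zx).
  rewrite (gm_sym p Z) gm_cross mulrC (cross_inner N1 Z1 xN xZ a0 yN).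
  by rewrite mulrC.
rewrite /w gmDl !gmZl vol3Dr !vol3Zr Jyx xJy.
set q := vol3 p N x y; set r := gm p y x.
transitivity ((a ^+ 2 - b ^+ 2) * (r * q) + a * b * (r ^+ 2 - q ^+ 2));
  first by ring.
by rewrite ab mul0r addr0.
Qed.

End TwoPlanes.

(** * Curves on a surface *)

Section SurfaceCurve.
Variables (R : realType) (kappa tau : R) (E : E_space kappa tau).
Variables (S : surface E) (I : set R) (g : R -> E) (c : R -> S).
Hypotheses (oI : open I) (sg : smooth_curve I g) (sc : smooth_curve I c).
Hypothesis hc : forall t, I t -> imm (c t) = g t.

Local Notation X := (velocity g).
Local Notation N t := (normal (c t)).
Local Notation Nc := (fun t => normal (c t)).
Local Notation T t := (tanT (c t)).

Lemma dimm_velocity t : I t -> dimm (c t) (velocity c t) = X t.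
Proof. exact: (differential_velocity oI (@imm_smooth _ _ _ _ S) sc hc). Qed.

Lemma shape_velocity t : I t ->
  Defs.shape (c t) (velocity c t) = - nabla_curve g Nc t.
Proof.
move=> It; congr (- _).
exact: (nabla_along_curve oI (@imm_smooth _ _ _ _ S) sc hc (@normal_smooth _ _
  _ _ S)).
Qed.

Lemma normal_along : smooth_along I g Nc.
Proof.
exact: (field_along oI (@imm_smooth _ _ _ _ S) sc hc (@normal_smooth _ _ _ _
  S)).
Qed.

Lemma normal_unit_along t : I t -> gm (g t) (N t) (N t) = 1.
Proof. by move=> It; rewrite -hc // normal_unit. Qed.

Lemma velocity_normal t : I t -> gm (g t) (X t) (N t) = 0.
Proof. by move=> It; rewrite -dimm_velocity // gm_sym -hc // normal_orth. Qed.

Lemma nabla_normal t : I t -> gm (g t) (nabla_curve g Nc t) (N t) = 0.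
Proof.
move=> It; have := gm_const_derive oI sg normal_along normal_along It
  normal_unit_along.
by rewrite [gm _ (N t) _]gm_sym => H; lra.
Qed.

Lemma tanT_normal t : I t -> gm (g t) (T t) (N t) = 0.
Proof.
move=> It; rewrite /tanT /nu (hc It) gmBl gmZl normal_unit_along // (gm_sym (g
  t) (xi _)).
by rewrite mulr1 subrr.
Qed.

Lemma tanT_velocity t : I t -> gm (g t) (T t) (X t) = gm (g t) (xi (g t)) (X t).
Proof.
move=> It; rewrite /tanT (hc It) gmBl gmZl (gm_sym (g t) (normal _)).
by rewrite velocity_normal // mulr0 subr0.
Qed.

Lemma tanT_norm t : I t ->
  gm (g t) (T t) (T t) = 1 - gm (g t) (N t) (xi (g t)) ^+ 2.
Proof.
move=> It; rewrite {2}/tanT (gmDr (g t)) gmNr gmZr tanT_normal // mulr0 subr0.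
rewrite /tanT (hc It) gmBl gmZl xi_unit /nu (hc It).
by rewrite expr2.
Qed.

Lemma rotJ_normal t x : I t -> gm (g t) (rotJ (c t) x) (N t) = 0.
Proof. by move=> It; rewrite /rotJ (hc It) gm_cross vol3_coord; ring. Qed.

Lemma tanT_angle_normal theta t : I t ->
  gm (g t) (tanT_angle theta (c t)) (N t) = 0.
Proof.
move=> It; rewrite /tanT_angle gmDl !gmZl tanT_normal // rotJ_normal //.
by rewrite !mulr0 addr0.
Qed.

Lemma smooth_map_id : smooth_map (fun p : E => p).
Proof.
split; first by move=> p.
by move=> a b aa ab; exact: atlas_smooth.
Qed.

Lemma xi_along : smooth_along I g (fun t => xi (g t)).
Proof.
have [sxi _] := xi_killing E.
exact: (field_along oI smooth_map_id sg (fun t _ => erefl (g t)) sxi).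
Qed.

Lemma xi_nabla_curve t : I t ->
  nabla_curve g (fun t => xi (g t)) t = tau *: cross (g t) (X t) (xi (g t)).
Proof.
move=> It; rewrite -xi_nabla; have [sxi _] := xi_killing E.
exact: (esym (nabla_along_curve oI smooth_map_id sg (fun t _ =>
  erefl (g t)) sxi It)).
Qed.

(** Since nabla_X xi = tau X /\ xi, the triple product of N, T, X is an inner
    product of nabla_X xi with N. *)
Lemma rotJ_tanT_velocity t : I t -> tau != 0 ->
  gm (g t) (rotJ (c t) (T t)) (X t) =
  - tau^-1 * gm (g t) (nabla_curve g (fun t => xi (g t)) t) (N t).
Proof.
move=> It t0; rewrite xi_nabla_curve // gmZl mulrA mulNr mulVf // mulN1r.
rewrite /rotJ (hc It) !gm_cross /tanT (hc It) !vol3_coord !mxE; ring.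
Qed.

(** All vectors are placed at g t, a point that does not refer to the surface,
    so that two surfaces through the curve can be compared. *)
Lemma S_AR_velocity H theta t : I t -> S_AR H theta (c t) (velocity c t) =
  let A := - nabla_curve g Nc t in let T2 := gm (g t) (T t) (T t) in
  if tau == 0 then
    (2 * H) *: A - (kappa * gm (g t) (X t) (T t)) *: T t
    + (kappa / 2 * T2) *: X t - (2 * H ^+ 2) *: X t
  else
    let alpha := (kappa - 4 * tau ^+ 2) / (2 * Num.sqrt (H ^+ 2 + tau ^+ 2)) in
    let Tt := tanT_angle theta (c t) in
    A - (alpha * gm (g t) Tt (X t)) *: Tt + (alpha * T2 / 2) *: X t - H *: X t.
Proof. by move=> It; rewrite /S_AR dimm_velocity // shape_velocity // (hc It).
  Qed.

Lemma S_AR_normal H theta t : I t ->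
  gm (g t) (S_AR H theta (c t) (velocity c t)) (N t) = 0.
Proof.
move=> It; rewrite S_AR_velocity //=.
move: (nabla_curve g Nc t) (nabla_normal It) => a aN; case: ifP => _.
  move: (tanT _) (tanT_normal It) => u uN.
  rewrite !(gmDl, gmNl, gmZl) aN uN (velocity_normal It); ring.
move: (tanT_angle _ _) (tanT_angle_normal theta It) (tanT _) => w wN u.
rewrite !(gmDl, gmNl, gmZl) aN wN (velocity_normal It); ring.
Qed.

(** After [rotJ_tanT_velocity], the function is a polynomial in inner products
    of X, N, xi and the covariant derivatives of N and xi. *)
Lemma S_AR_smooth H theta : @smooth_on R R^o R^o I
  (fun t => gm (g t) (S_AR H theta (c t) (velocity c t)) (X t)).
Proof.
move=> k; have sX := velocity_along oI sg; have sN := normal_along.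
have sxi := xi_along.
have cA := gm_along oI sg (nabla_curve_along oI sg sN) sX k.
have cX := gm_along oI sg sX sX k.
have cxX := gm_along oI sg sxi sX k.
have cnu := gm_along oI sg sN sxi k.
have cJ := gm_along oI sg (nabla_curve_along oI sg sxi) sN k.
have C (a : R) := Ck_cst (V := R^o) (W := R^o) k I a.
have M := @Ck_scale R R^o R^o k I.
(* In both cases H0 writes the function as a polynomial in cA, cX, cxX, cnu and
   cJ, using |T|^2 = 1 - nu^2. *)
case: (boolP (tau == 0)) => t0.
  have H0 := Ck_add oI (Ck_add oI (M _ _ oI (C (- (2 * H))) cA)
    (M _ _ oI (C (- kappa)) (M _ _ oI cxX cxX)))
    (Ck_add oI (M _ _ oI (C (kappa / 2 - 2 * H ^+ 2)) cX)
    (M _ _ oI (C (- (kappa / 2))) (M _ _ oI (M _ _ oI cnu cnu) cX))).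
  apply: (Ck_ext oI) H0 => t It; rewrite S_AR_velocity //= t0.
  move: (tanT _) (tanT_norm It) (tanT_velocity It) => u uu uX.
  move: (nabla_curve g Nc t) => a.
  rewrite !(gmDl, gmNl, gmZl) (gm_sym (g t) (X t) u) uu uX.
  by rewrite /GRing.scale /=; ring.
pose alpha := (kappa - 4 * tau ^+ 2) / (2 * Num.sqrt (H ^+ 2 + tau ^+ 2)).
have cP := Ck_add oI (M _ _ oI (C (cos theta)) cxX)
  (M _ _ oI (C (- sin theta * tau^-1)) cJ).
have H0 := Ck_add oI (Ck_add oI (M _ _ oI (C (- 1)) cA)
  (M _ _ oI (C (- alpha)) (M _ _ oI cP cP)))
  (Ck_add oI (M _ _ oI (C (alpha / 2 - H)) cX)
  (M _ _ oI (C (- (alpha / 2))) (M _ _ oI (M _ _ oI cnu cnu) cX))).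
apply: (Ck_ext oI) H0 => t It; rewrite S_AR_velocity //= (negPf t0) -/alpha.
rewrite /tanT_angle; have := rotJ_tanT_velocity It t0.
move: (rotJ _ _) => w wX.
move: (tanT _) (tanT_norm It) (tanT_velocity It) => u uu uX.
move: (nabla_curve g Nc t) => a.
move: (nabla_curve g (fun t => xi (g t)) t) wX => b wX.
rewrite !(gmDl, gmNl, gmZl) uu wX uX.
by rewrite /GRing.scale /=; ring.
Qed.

Hypothesis X0 : forall t, I t -> X t != 0.

(** S_AR X is tangent, so it is proportional to X as soon as its component along
    J X vanishes.  The factor is then <S_AR X, X> / <X, X>, which is smooth. *)
Lemma AR_lineP H theta : AR_line H theta I c <-> forall t, I t ->
  vol3 (g t) (N t) (X t) (S_AR H theta (c t) (velocity c t)) = 0.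
Proof.
split=> [[l _ Hl] t It|H0].
  by rewrite Hl // dimm_velocity // vol3Zr vol3_xx mulr0.
exists (fun t => gm (g t) (S_AR H theta (c t) (velocity c t)) (X t) /
                 gm (g t) (X t) (X t)).
  move=> k; have cX := gm_along oI sg (velocity_along oI sg) (velocity_along oI
    sg) k.
  have XX t : I t -> gm (g t) (X t) (X t) != 0.
    by move=> It; rewrite gt_eqF // gm_pos // X0.
  exact: Ck_scale oI (S_AR_smooth H theta k) (Ck_inv oI XX cX).
move=> t It; rewrite dimm_velocity //.
apply: tangent_collinear (normal_unit_along It) (X0 It) (velocity_normal It) _
  (H0 t It).
exact: S_AR_normal.
Qed.

Lemma vol3_S_AR H theta t : I t ->
  vol3 (g t) (N t) (X t) (S_AR H theta (c t) (velocity c t)) =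
  let Q := vol3 (g t) (N t) (X t) (- nabla_curve g Nc t) in
  if tau == 0 then
    2 * H * Q - kappa * (gm (g t) (T t) (X t) * vol3 (g t) (N t) (X t) (T t))
  else
    let alpha := (kappa - 4 * tau ^+ 2) / (2 * Num.sqrt (H ^+ 2 + tau ^+ 2)) in
    let Tt := tanT_angle theta (c t) in
    Q - alpha * (gm (g t) Tt (X t) * vol3 (g t) (N t) (X t) Tt).
Proof.
move=> It; rewrite S_AR_velocity //=.
move: (- nabla_curve g Nc t) => a; case: ifP => _.
  move: (tanT _) => u; rewrite !(vol3Dr, vol3Nr, vol3Zr) vol3_xx.
  by rewrite (gm_sym (g t) (X t) u); ring.
move: (tanT_angle _ _) (tanT _) => w u.
by rewrite !(vol3Dr, vol3Nr, vol3Zr) vol3_xx; ring.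
Qed.

End SurfaceCurve.

(** * Two surfaces along a curve *)

(** For tau = 0 the angle 2 theta is 0 or pi modulo 2 pi, according to the sign
    of H. *)
Lemma AR_angle_horizontal (R : realType) (H tau theta : R) : tau = 0 ->
  AR_angle H tau theta ->
  cos theta * sin theta = 0 /\ cos theta ^+ 2 - sin theta ^+ 2 = H / `|H|.
Proof.
move=> -> [c2 s2]; rewrite expr0n /= addr0 sqrtr_sqr mul0r in c2 s2.
have two : 2 * theta = theta + theta by ring.
rewrite -c2 two cosD; rewrite two sinD in s2.
by split; [lra|ring].
Qed.

Section Intersection.
Variables (R : realType) (kappa tau : R) (E : E_space kappa tau).
Variables (S1 S2 : surface E) (H1 H2 theta1 theta2 : R).
Hypotheses (H1_neq0 : H1 ^+ 2 + tau ^+ 2 != 0)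
  (H2_neq0 : H2 ^+ 2 + tau ^+ 2 != 0)
  (angle1 : AR_angle H1 tau theta1) (angle2 : AR_angle H2 tau theta2).
Variables (I : set R) (g : R -> E) (c1 : R -> S1) (c2 : R -> S2).
Hypotheses (oI : open I) (rg : regular_curve I g)
  (sc1 : smooth_curve I c1) (hc1 : forall t, I t -> imm (c1 t) = g t)
  (sc2 : smooth_curve I c2) (hc2 : forall t, I t -> imm (c2 t) = g t).
Hypothesis transversal : forall t, I t -> forall w : 'rV[R]_3,
  exists v1 v2 : 'rV[R]_2, w = dimm (c1 t) v1 + dimm (c2 t) v2.

Local Notation X := (velocity g).
Local Notation N1 t := (normal (c1 t)).
Local Notation N2 t := (normal (c2 t)).

Lemma normals_transversal t : I t -> vol3 (g t) (N1 t) (X t) (N2 t) != 0.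
Proof.
move=> It; apply: transversal_vol3.
- exact: (normal_unit_along hc1 It).
- exact: (normal_unit_along hc2 It).
- exact: rg.2.
- exact: (velocity_normal oI sc1 hc1 It).
- exact: (velocity_normal oI sc2 hc2 It).
move=> w; have [v1 [v2 ->]] := transversal It w.
exists (dimm (c1 t) v1), (dimm (c2 t) v2); split=> //.
  by rewrite -(hc1 It); exact: normal_orth.
by rewrite -(hc2 It); exact: normal_orth.
Qed.

Lemma geodesic_torsion_eq k t :
  (forall s, I s -> gm (g s) (N1 s) (N2 s) = k) -> I t ->
  vol3 (g t) (N1 t) (X t) (- nabla_curve g (fun s => N1 s) t) =
  vol3 (g t) (N2 t) (X t) (- nabla_curve g (fun s => N2 s) t).
Proof.
move=> hk It; have sg := rg.1.
apply: (torsion_eq _ _ _ _ (normals_transversal It)).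
- exact: (normal_unit_along hc1 It).
- exact: (normal_unit_along hc2 It).
- exact: (velocity_normal oI sc1 hc1 It).
- exact: (velocity_normal oI sc2 hc2 It).
- by rewrite gmNl (nabla_normal oI sg sc1 hc1 It) oppr0.
- by rewrite gmNl (nabla_normal oI sg sc2 hc2 It) oppr0.
rewrite gmNl gmNr -opprD.
rewrite (gm_const_derive oI sg (normal_along oI sc1 hc1)
  (normal_along oI sc2 hc2) It hk).
by rewrite oppr0.
Qed.

Local Notation P1 t := (gm (g t) (tanT_angle theta1 (c1 t)) (X t) *
  vol3 (g t) (N1 t) (X t) (tanT_angle theta1 (c1 t))).
Local Notation P2 t := (gm (g t) (tanT_angle theta2 (c2 t)) (X t) *
  vol3 (g t) (N2 t) (X t) (tanT_angle theta2 (c2 t))).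
Local Notation r1 := (Num.sqrt (H1 ^+ 2 + tau ^+ 2)).
Local Notation r2 := (Num.sqrt (H2 ^+ 2 + tau ^+ 2)).

(** Expanded with [condition_product], both sides of b) carry the same factors:
    |X|^4 and the squared volume of N_1, X, N_2, which is nonzero by
    transversality. *)
Lemma condition_along t : I t ->
  r1 * gm (g t) (tanT_angle theta2 (c2 t)) (N1 t) *
    gm (g t) (rotJ (c2 t) (tanT_angle theta2 (c2 t))) (N1 t) =
  r2 * gm (g t) (tanT_angle theta1 (c1 t)) (N2 t) *
    gm (g t) (rotJ (c1 t) (tanT_angle theta1 (c1 t))) (N2 t) ->
  r1 * P2 t = r2 * P1 t.
Proof.
move=> It; rewrite /rotJ (hc1 It) (hc2 It) => hb.
have a0 := normals_transversal It.
have n1 := normal_unit_along hc1 It; have n2 := normal_unit_along hc2 It.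
have x1 := velocity_normal oI sc1 hc1 It;
  have x2 := velocity_normal oI sc2 hc2 It.
have t1 := tanT_angle_normal hc1 theta1 It.
have t2 := tanT_angle_normal hc2 theta2 It.
have a0' : vol3 (g t) (N2 t) (X t) (N1 t) != 0 by rewrite normals_swap oppr_eq0.
have E1 := condition_product n1 n2 x1 x2 a0 t1.
have E2 := condition_product n2 n1 x2 x1 a0' t2.
rewrite normals_swap sqrrN in E2.
apply: (mulfI (expf_neq0 2 a0)).
rewrite mulrCA -E2 [RHS]mulrCA -E1.
have assoc (r u w x : R) : r * (u * w * x) = r * u * w * x by rewrite !mulrA.
by rewrite assoc hb [RHS]assoc.
Qed.

(** With equal geodesic torsions only the terms in T_theta differ; b) makes them
    equal for tau <> 0, and makes H_2 times the first number equal to H_1 times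
    the second for tau = 0. *)
Lemma vol3_S_AR_eq k t : (forall s, I s -> gm (g s) (N1 s) (N2 s) = k) ->
  I t -> r1 * P2 t = r2 * P1 t ->
  vol3 (g t) (N1 t) (X t) (S_AR H1 theta1 (c1 t) (velocity c1 t)) = 0 <->
  vol3 (g t) (N2 t) (X t) (S_AR H2 theta2 (c2 t) (velocity c2 t)) = 0.
Proof.
move=> hk It hb; have sg := rg.1.
have n1 := normal_unit_along hc1 It; have n2 := normal_unit_along hc2 It.
have x1 := velocity_normal oI sc1 hc1 It;
  have x2 := velocity_normal oI sc2 hc2 It.
rewrite (vol3_S_AR oI sc1 hc1 H1 theta1 It) (vol3_S_AR oI sc2 hc2 H2 theta2 It)
  /=.
rewrite (geodesic_torsion_eq hk It); set Q := vol3 _ _ _ (- _).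
case: ifP => [/eqP tau0|_]; last first.
  suff -> : (kappa - 4 * tau ^+ 2) / (2 * r1) * P1 t =
            (kappa - 4 * tau ^+ 2) / (2 * r2) * P2 t by [].
  have r10 : r1 != 0.
    by rewrite gt_eqF // sqrtr_gt0 lt0r H1_neq0 addr_ge0 ?sqr_ge0.
  have r20 : r2 != 0.
    by rewrite gt_eqF // sqrtr_gt0 lt0r H2_neq0 addr_ge0 ?sqr_ge0.
  move: (P1 t) (P2 t) hb => p1 p2 hb.
  have -> : p1 = r1 * p2 / r2 by rewrite hb mulrAC mulfV // mul1r.
  by field; rewrite r10 r20.
have a0 := normals_transversal It.
have a0' : vol3 (g t) (N2 t) (X t) (N1 t) != 0 by rewrite normals_swap oppr_eq0.
have [cs1 cc1] := AR_angle_horizontal tau0 angle1.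
have [cs2 cc2] := AR_angle_horizontal tau0 angle2.
have E1 : P1 t = H1 / `|H1| * (gm (g t) (tanT (c1 t)) (X t) *
    vol3 (g t) (N1 t) (X t) (tanT (c1 t))).
  rewrite -cc1 /tanT_angle /rotJ (hc1 It).
  exact: (rotated_product n1 n2 (rg.2 t It) x1 x2 a0 (tanT_normal hc1 It) cs1).
have E2 : P2 t = H2 / `|H2| * (gm (g t) (tanT (c2 t)) (X t) *
    vol3 (g t) (N2 t) (X t) (tanT (c2 t))).
  rewrite -cc2 /tanT_angle /rotJ (hc2 It).
  exact: (rotated_product n2 n1 (rg.2 t It) x2 x1 a0' (tanT_normal hc2 It) cs2).
move: hb; rewrite {}E1 {}E2.
set p1 := gm _ _ _ * vol3 _ _ _ (tanT (c1 t)).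
set p2 := gm _ _ _ * vol3 _ _ _ (tanT (c2 t)).
move: p1 p2 => p1 p2.
move: H1_neq0 H2_neq0; rewrite tau0 expr0n /= !addr0 !sqrtr_sqr !sqrf_eq0 =>
  h1 h2.
move=> hb; have {}hb : H1 * p2 = H2 * p1.
  have n1' : `|H1| != 0 by rewrite normr_eq0.
  have n2' : `|H2| != 0 by rewrite normr_eq0.
  apply: (mulfI (mulf_neq0 h1 h2)).
  have S1E : `|H1| * `|H1| = H1 * H1 by rewrite -expr2 real_normK ?num_real.
  have S2E : `|H2| * `|H2| = H2 * H2 by rewrite -expr2 real_normK ?num_real.
  transitivity (`|H1| * `|H1| * (H2 * p2)); first by rewrite S1E; ring.
  transitivity (`|H2| * `|H2| * (H1 * p1)); last by rewrite S2E; ring.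
  transitivity (`|H1| * `|H2| * (`|H1| * (H2 / `|H2| * p2))); first by field.
  by rewrite hb; field.
have K : H2 * (2 * H1 * Q - kappa * p1) = H1 * (2 * H2 * Q - kappa * p2).
  transitivity (2 * H1 * H2 * Q - kappa * (H2 * p1)); first by ring.
  by rewrite -hb; ring.
split=> Z; [apply: (mulfI h1)|apply: (mulfI h2)].
  by rewrite -K Z !mulr0.
by rewrite K Z !mulr0.
Qed.

End Intersection.

Theorem mainTheorem4 (R : realType) (kappa tau : R)
  (hkappa : [\/ kappa = -1, kappa = 0 | kappa = 1])
  (hkappatau : kappa - 4 * tau ^+ 2 != 0)
  (E : E_space kappa tau)
  (S1 S2 : surface E) (H1 H2 : R)
  (hS1 : H_surface S1 H1) (hS2 : H_surface S2 H2)
  (hH1 : H1 ^+ 2 + tau ^+ 2 != 0) (hH2 : H2 ^+ 2 + tau ^+ 2 != 0)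
  (hS12 : exists (p1 : S1) (p2 : S2), imm p1 = imm p2)
  (theta1 theta2 : R)
  (htheta1 : AR_angle H1 tau theta1) (htheta2 : AR_angle H2 tau theta2)
  (I : set R) (hIopen : open I) (hIitv : is_interval I) (hI0 : I !=set0)
  (gamma : R -> E) (hgamma : regular_curve I gamma)
  (c1 : R -> S1) (hc1 : smooth_curve I c1)
  (hc1gamma : forall t, I t -> imm (c1 t) = gamma t)
  (c2 : R -> S2) (hc2 : smooth_curve I c2)
  (hc2gamma : forall t, I t -> imm (c2 t) = gamma t)
  (htransversal : forall t, I t -> forall w : 'rV[R]_3,
     exists v1 v2 : 'rV[R]_2, w = dimm (c1 t) v1 + dimm (c2 t) v2)
  (ha : exists k : R, forall t, I t ->
     gm (gamma t) (normal (c1 t)) (normal (c2 t)) = k)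
  (hb : forall t, I t ->
     let N1 := normal (c1 t) in
     let N2 := normal (c2 t) in
     let T1 := tanT_angle theta1 (c1 t) in
     let T2 := tanT_angle theta2 (c2 t) in
     Num.sqrt (H1 ^+ 2 + tau ^+ 2)
       * gm (gamma t) T2 N1 * gm (gamma t) (rotJ (c2 t) T2) N1 =
     Num.sqrt (H2 ^+ 2 + tau ^+ 2)
       * gm (gamma t) T1 N2 * gm (gamma t) (rotJ (c1 t) T1) N2) :
  AR_line H1 theta1 I c1 <-> AR_line H2 theta2 I c2.
Proof.
have [k hk] := ha; have sg := hgamma.1; have X0 := hgamma.2.
have pointwise t (It : I t) := vol3_S_AR_eq hH1 hH2 htheta1 htheta2 hIopen
  hgamma
  hc1 hc1gamma hc2 hc2gamma htransversal hk It
  (condition_along hIopen hgamma hc1 hc1gamma hc2 hc2gamma htransversal It (hb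
    t It)).
rewrite (AR_lineP hIopen sg hc1 hc1gamma X0) (AR_lineP hIopen sg hc2 hc2gamma
  X0).
split=> H t It; first exact: ((pointwise t It).1 (H t It)).
exact: ((pointwise t It).2 (H t It)).
Qed.
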